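(* There exists a constant $C>0$, independent of $\epsilon$ and of the discretization parameters $h$ and $\tau$, such that the following holds. Let $(p^\epsilon_{h,\tau},m^\epsilon_{h,\tau})$ and $(p^0_{h,\tau},m^0_{h,\tau})$ be the solutions of the discrete problem with parameter $\epsilon>0$ (with initial data $p_0,m_0$) and with parameter $\epsilon=0$, respectively, and assume that $p^\epsilon_{h,\tau}(0)=p^0_{h,\tau}(0)$. Then for all $k\ge 0$ $$\|p^\epsilon_{h,\tau}(t^k)-p^0_{h,\tau}(t^k)\|^2+2\underline a\sum_{j=1}^k\tau\,\|m^\epsilon_{h,\tau}(t^j)-m^0_{h,\tau}(t^j)\|^2\le C\epsilon^4\Big(\|\partial_x m_0\|^2+\frac1{\epsilon^2}\|\partial_x p_0+a\,m_0\|^2+\frac{\overline a^2}{\epsilon^2}\|m_0\|^2\Big).$$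
   Context: Let $a:(0,1)\to\mathbb{R}$ be a fixed measurable function with $0<\underline a\le a(x)\le\overline a$ for constants $\underline a,\overline a$, let $g_0,g_1\in\mathbb{R}$, and let the initial data $p_0,m_0\in H^1(0,1)$ satisfy $p_0(0)=g_0$, $p_0(1)=g_1$. $(\cdot,\cdot)$ and $\|\cdot\|$ denote the scalar product and norm of $L^2(0,1)$. Let $T_h=\{e\}$ be a uniform mesh of $(0,1)$ into elements (subintervals) $e$ of size $h$, and set $$Q_h=\{q\in L^2(0,1): q|_e\in P_0(e)\ \forall e\in T_h\},\qquad V_h=\{v\in C[0,1]: v|_e\in P_1(e)\ \forall e\in T_h\},$$ the spaces of piecewise constant and of continuous piecewise linear functions. Let $\tau>0$ be the time step, $t^k=k\tau$, and $\bar\partial_\tau u(t^k)=\frac1\tau[u(t^k)-u(t^{k-1})]$. Discrete problem with parameter $\epsilon\ge0$: let $p^\epsilon_{h,\tau}(0)\in Q_h$ and $m^\epsilon_{h,\tau}(0)\in V_h$ be the $L^2$-orthogonal projections of the initial data $p_0$, $m_0$ onto $Q_h$, $V_h$ (for $\epsilon=0$ the value $m^0_{h,\tau}(0)$ plays no role). For $k\ge1$ find $(p^\epsilon_{h,\tau}(t^k),m^\epsilon_{h,\tau}(t^k))\in Q_h\times V_h$ such that $$(\bar\partial_\tau p^\epsilon_{h,\tau}(t^k),q_h)+(\partial_x m^\epsilon_{h,\tau}(t^k),q_h)=0,$$ $$\epsilon^2(\bar\partial_\tau m^\epsilon_{h,\tau}(t^k),v_h)-(p^\epsilon_{h,\tau}(t^k),\partial_x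 v_h)+(a\,m^\epsilon_{h,\tau}(t^k),v_h)=g_0v_h(0)-g_1v_h(1)$$ for all $q_h\in Q_h$ and $v_h\in V_h$. This problem has a unique solution. *)

(* Defs.v *)
From HB Require Import structures.
From mathcomp Require Import all_boot all_order all_algebra.
From mathcomp Require Import all_classical all_reals all_analysis.

Set Implicit Arguments.
Unset Strict Implicit.
Unset Printing Implicit Defensive.

Import Order.TTheory GRing.Theory Num.Theory.
Import numFieldNormedType.Exports.

Local Open Scope classical_set_scope.
Local Open Scope ring_scope.

(* MathComp-Analysis. Elements of function spaces on (0,1) are represented by
   functions R -> R, whose values outside (0,1) (outside [0,1] for continuous
   functions) are irrelevant. *)

Section defs.
Context {R : realType}.
Implicit Types (u v w q phi : R -> R) (W : set (R -> R)).

Definition leb : {measure set (measurableTypeR R) -> \bar R} :=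
  @lebesgue_measure R.

Definition unit_itv : set R := `]0, 1[.

Definition ip u v : R := \int[leb]_(x in unit_itv) (u x * v x).

Definition L2norm u : R := Num.sqrt (ip u u).

Definition in_L2 u : Prop :=
  measurable_fun unit_itv u /\
  leb.-integrable unit_itv (fun x => (u x ^+ 2)%:E).

(* C^1_c(0,1), each function being extended by zero *)
Definition test_function phi : Prop :=
  [/\ forall x, derivable phi x 1,
      continuous (derive1 phi) &
      exists K : set R,
        [/\ compact K, K `<=` unit_itv & forall x, ~ K x -> phi x = 0]].

Definition weak_derivative u u' : Prop :=
  forall phi, test_function phi -> ip u (derive1 phi) = - ip u' phi.

(* u is in H^1(0,1) and u' represents its weak derivative *)
Definition H1_with_derivative u u' : Prop :=
  [/\ in_L2 u, in_L2 u' & weak_derivative u u'].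

(* boundary values in the sense of the continuous representative *)
Definition boundary_values u (g0 g1 : R) : Prop :=
  exists uc : R -> R,
    [/\ {within `[0, 1]%classic, continuous uc}, ae_eq leb unit_itv u uc,
        uc 0 = g0 & uc 1 = g1].

(* i-th node of the uniform mesh with n elements, i.e. of mesh size h = 1/n *)
Definition node (n i : nat) : R := i%:R / n%:R.

(* The values at the nodes, a null set, are left free. *)
Definition Qh (n : nat) : set (R -> R) :=
  [set q : R -> R | forall i, (i < n)%N ->
     exists c : R, forall x, x \in `]node n i, node n i.+1[ -> q x = c].

Definition Vh (n : nat) : set (R -> R) :=
  [set v : R -> R | {within `[0, 1]%classic, continuous v} /\
     forall i, (i < n)%N ->
       exists c d : R, forall x, x \in `[node n i, node n i.+1] ->
         v x = c + d * x].

Definition L2_projection W u w : Prop :=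
  W w /\ forall v, W v -> ip (u \- w) v = 0.

(* backward difference quotient (u(t^k) - u(t^(k-1))) / tau, for k >= 1 *)
Definition dtau (tau : R) (u : nat -> R -> R) (k : nat) : R -> R :=
  fun x => (u k x - u k.-1 x) / tau.

(* (p k, m k) are the values at t^k = k tau. For v in V_h, derive1 v is the
   classical derivative inside the elements and arbitrary at the nodes. For
   eps = 0 the function m 0 is unconstrained, since it is only multiplied by
   eps ^+ 2 = 0. *)
Definition discrete_solution (a : R -> R) (g0 g1 : R) (p0 m0 : R -> R)
    (n : nat) (tau eps : R) (p m : nat -> R -> R) : Prop :=
  [/\ L2_projection (Qh n) p0 (p 0%N),
      0 < eps -> L2_projection (Vh n) m0 (m 0%N) &
      forall k, (0 < k)%N ->
        [/\ Qh n (p k), Vh n (m k),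
            forall q, Qh n q -> ip (dtau tau p k) q + ip (derive1 (m k)) q = 0 &
            forall v, Vh n v ->
              eps ^+ 2 * ip (dtau tau m k) v - ip (p k) (derive1 v)
                + ip (fun x => a x * m k x) v = g0 * v 0 - g1 * v 1]].

End defs.

(* Main.v *)
Require Import Defs.
From HB Require Import structures.
From mathcomp Require Import all_boot all_order all_algebra.
From mathcomp Require Import all_classical all_reals all_analysis.
From mathcomp Require Import measurable_realfun ring lra.

Import Order.TTheory GRing.Theory Num.Theory.
Import numFieldNormedType.Exports.

Local Open Scope classical_set_scope.
Local Open Scope ring_scope.

(** The error p^eps - p^0, m^eps - m^0 solves the scheme of the limit problem with
    the forcing - eps^2 times the difference quotient d^k of m^eps. Testing with
    the error itself and absorbing half of the forcing in the damping gives
    [comparison_sum]: the left side of the theorem is at most eps^4 times the sum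
    of tau |d^k|^2, up to a constant. It remains to bound that sum by the data,
    uniformly in h, tau and eps.

    The difference quotients r^k of p^eps and d^k of m^eps solve the scheme with
    zero data, so their energy |r^k|^2 + eps^2 |d^k|^2 decreases and the decrease controls
    tau |d^k|^2 ([energy_decay]). For the first quotients ([energy_first]) one
    tests the first step: integrating p0 by parts removes the boundary terms and
    leaves the residual dp0 + a m0 paired with d^1, and the gradient of the
    projection of m0 paired with r^1. The former costs a factor 1 / eps^2 because
    d^1 is only controlled through eps^2 |d^1|^2; the latter needs that the
    L^2-projection onto V_h is stable in H^1 uniformly in h.

    That stability ([L2_projection_H1_stable]) is the usual combination of an
    interpolation error of order h with the inverse inequality. Both it and the
    integration by parts ([Vh_by_parts]) need point values of H^1 functions. So
    a function with a square integrable weak derivative is first shown to be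
    almost everywhere a primitive of it ([weak_derivative_primitive]): smoothed
    indicator functions of [x, y] are admissible test functions, and shrinking
    the smoothing scale gives u(y) - u(x) as the integral of u' whenever x and y
    are Lebesgue points of u. *)

(** * Integrals over subintervals of the unit interval *)

Section Integrals.
Context {R : realType}.
Implicit Types (f g h u v w : R -> R) (a b c s x y M : R).

Definition integrable01 f : Prop := (@leb R).-integrable unit_itv (EFin \o f).

(** Open intervals, so that values at 0 and 1 never matter. *)
Definition itg f a b : R := \int[@leb R]_(x in `]a, b[) f x.

Lemma measurable_oo a b : measurable (`]a, b[%classic : set (measurableTypeR R)).
Proof. exact: measurable_itv. Qed.
#[local] Hint Resolve measurable_oo : core.

Lemma measurable_unit_itv : measurable (@unit_itv R : set (measurableTypeR R)).
Proof. exact: measurable_itv. Qed.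
#[local] Hint Resolve measurable_unit_itv : core.

Lemma integrable01_sub f a b : 0 <= a -> b <= 1 -> integrable01 f ->
  (@leb R).-integrable `]a, b[ (EFin \o f).
Proof.
move=> a0 b1; apply: integrableS => //; by apply: subset_itv; rewrite bnd_simp.
Qed.

Lemma integrable01D f g : integrable01 f -> integrable01 g ->
  integrable01 (fun x => f x + g x).
Proof.
move=> ff fg; have := integrableD measurable_unit_itv ff fg.
by apply: eq_integrable.
Qed.

Lemma integrable01Z s f : integrable01 f -> integrable01 (fun x => s * f x).
Proof.
move=> ff; have := integrableZl measurable_unit_itv s ff.
by apply: eq_integrable.
Qed.

Lemma integrable01B f g : integrable01 f -> integrable01 g ->
  integrable01 (fun x => f x - g x).
Proof.
move=> ff fg; have := integrableB measurable_unit_itv ff fg.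
by apply: eq_integrable.
Qed.

Lemma integrable01_norm f : integrable01 f -> integrable01 (fun x => `|f x|).
Proof. by move=> ff; have := integrable_norm ff. Qed.

Lemma integrable01_meas f : integrable01 f -> measurable_fun (@unit_itv R) f.
Proof. by move=> /measurable_int /measurable_EFinP. Qed.

Lemma integrable01_cst s : integrable01 (fun=> s).
Proof.
apply: measurable_bounded_integrable => //=.
- by rewrite /leb /unit_itv /= lebesgue_measure_itv/=; case: ifP => _; rewrite ltry.
- by exists `|s|; split => // M /= /ltW.
Qed.

Lemma integrable01_bounded f M : measurable_fun (@unit_itv R) f ->
  (forall x, 0 < x < 1 -> `|f x| <= M) -> integrable01 f.
Proof.
move=> mf fM; have : integrable01 (fun=> M) by exact: integrable01_cst.
apply: le_integrable => //; first exact/measurable_EFinP.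
move=> x; rewrite /unit_itv/= in_itv/= => x01.
by rewrite lee_fin (le_trans (fM _ x01))// ler_norm.
Qed.

Lemma integrable01Ml f h M : measurable_fun (@unit_itv R) h ->
  (forall x, 0 < x < 1 -> `|h x| <= M) -> integrable01 f ->
  integrable01 (fun x => h x * f x).
Proof.
move=> mh hM ff; have := integrable01Z M _ ff.
apply: le_integrable => //.
  by apply/measurable_EFinP; apply: measurable_funM => //; exact: integrable01_meas.
move=> x; rewrite /unit_itv/= in_itv/= => x01.
rewrite lee_fin !normrM ler_wpM2r// (le_trans (hM _ x01))// ler_norm//.
Qed.

Lemma eq_itg f g a b : (forall x, a < x < b -> f x = g x) ->
  itg f a b = itg g a b.
Proof.
move=> fg; apply: eq_Rintegral => x; rewrite inE/= in_itv/=; exact: fg.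
Qed.

Lemma itg_ge f a b : b <= a -> itg f a b = 0.
Proof. by move=> ba; rewrite /itg set_itv_ge ?Rintegral_set0// bnd_simp -leNgt. Qed.

Section Subinterval.
Variables (a b : R) (a0 : 0 <= a) (b1 : b <= 1).

Lemma itgD f g : integrable01 f -> integrable01 g ->
  itg (fun x => f x + g x) a b = itg f a b + itg g a b.
Proof. by move=> ff fg; rewrite /itg RintegralD//; exact: integrable01_sub. Qed.

Lemma itgB f g : integrable01 f -> integrable01 g ->
  itg (fun x => f x - g x) a b = itg f a b - itg g a b.
Proof. by move=> ff fg; rewrite /itg RintegralB//; exact: integrable01_sub. Qed.

Lemma itgZ s f : integrable01 f -> itg (fun x => s * f x) a b = s * itg f a b.
Proof. by move=> ff; rewrite /itg RintegralZl//; exact: integrable01_sub. Qed.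

Lemma le_itg f g : integrable01 f -> integrable01 g ->
  (forall x, a < x < b -> f x <= g x) -> itg f a b <= itg g a b.
Proof.
by move=> ff fg fgle; apply: le_Rintegral => //; exact: integrable01_sub.
Qed.

Lemma itg_norm f : integrable01 f -> `|itg f a b| <= itg (fun x => `|f x|) a b.
Proof. by move=> ff; apply: le_normr_Rintegral => //; exact: integrable01_sub. Qed.

End Subinterval.

Lemma itg_ge0 f a b : (forall x, a < x < b -> 0 <= f x) -> 0 <= itg f a b.
Proof.
by move=> f0; apply: Rintegral_ge0 => x /=; rewrite in_itv/=; exact: f0.
Qed.

Lemma itg_cst s a b : a <= b -> itg (fun=> s) a b = s * (b - a).
Proof.
move=> ab; rewrite /itg Rintegral_cst//= /leb lebesgue_measure_itv/= lte_fin.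
case: ltP => //= ba; have -> : a = b by apply/eqP; rewrite eq_le ab.
by rewrite subrr.
Qed.

Lemma itg_split f a b c : 0 <= a -> a <= b -> b <= c -> c <= 1 -> integrable01 f ->
  itg f a c = itg f a b + itg f b c.
Proof.
move=> a0 ab bc c1 ff; have [->|nbc] := eqVneq b c.
  by rewrite [itg f c c]itg_ge// addr0.
have ltbc : b < c by rewrite lt_neqAle nbc.
have := @Rintegral_itvB R f (BRight a) (BLeft c) b.
move=> /(_ (integrable01_sub _ _ _ a0 c1 ff)); rewrite !bnd_simp => /(_ ab ltbc).
rewrite -Rintegral_itv_bndo_bndc; last exact: (integrable01_sub f a b a0 (le_trans bc c1) ff).
by rewrite /itg => <-; rewrite addrC subrK.
Qed.

(** Cauchy-Schwarz against a constant: the variance of f about its mean is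
    nonnegative. *)
Lemma sqr_itg_le f a b : 0 <= a -> a <= b -> b <= 1 ->
  integrable01 f -> integrable01 (fun x => f x ^+ 2) ->
  itg f a b ^+ 2 <= (b - a) * itg (fun x => f x ^+ 2) a b.
Proof.
move=> a0 ab b1 ff ff2; have [->|nab] := eqVneq a b.
  by rewrite !itg_ge// expr0n/= mulr0.
have ab0 : 0 < b - a by rewrite subr_gt0 lt_neqAle nab.
pose s := itg f a b / (b - a).
have : 0 <= itg (fun x => (f x - s) ^+ 2) a b.
  by apply: itg_ge0 => x _; exact: sqr_ge0.
have -> : itg (fun x => (f x - s) ^+ 2) a b =
    itg (fun x => f x ^+ 2) a b - itg f a b ^+ 2 / (b - a).
  rewrite (_ : itg _ _ _ =
      itg (fun x => (f x ^+ 2 - (2 * s) * f x) + s ^+ 2) a b); last first.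
    by apply: eq_itg => x _; ring.
  have ffs := integrable01Z (2 * s) f ff.
  rewrite itgD//; [|exact: integrable01B|exact: integrable01_cst].
  rewrite itgB// itgZ// itg_cst//.
  by rewrite /s; field; rewrite gt_eqF.
by rewrite subr_ge0 ler_pdivrMr// mulrC.
Qed.

End Integrals.
#[export] Hint Resolve measurable_oo measurable_unit_itv : core.

(** * The space L^2(0,1) *)

Section L2.
Context {R : realType}.
Implicit Types (h u v w : R -> R) (s M : R).

Lemma in_L2_integrable01M u v : in_L2 u -> in_L2 v -> integrable01 (fun x => u x * v x).
Proof.
move=> [mu u2] [mv v2]; have := integrable01D _ _ u2 v2.
apply: le_integrable => //; first by apply/measurable_EFinP; exact: measurable_funM.
move=> x _; rewrite lee_fin [leRHS]ger0_norm ?addr_ge0 ?sqr_ge0//.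
by rewrite normrM -(real_normK (num_real (u x))) -(real_normK (num_real (v x))); nra.
Qed.

Lemma in_L2_sqr u : in_L2 u -> integrable01 (fun x => u x ^+ 2).
Proof. by case. Qed.

Lemma in_L2D u v : in_L2 u -> in_L2 v -> in_L2 (fun x => u x + v x).
Proof.
move=> Lu Lv; split; first by case: Lu Lv => mu _ [mv _]; exact: measurable_funD.
have := integrable01D _ _ (integrable01D _ _ (in_L2_sqr _ Lu) (in_L2_sqr _ Lv))
  (integrable01Z 2 _ (in_L2_integrable01M _ _ Lu Lv)).
by apply: eq_integrable => // x _ /=; congr EFin; ring.
Qed.

Lemma in_L2Z s u : in_L2 u -> in_L2 (fun x => s * u x).
Proof.
move=> Lu; split; first by case: Lu => mu _; exact: measurable_funM.
have := integrable01Z (s ^+ 2) _ (in_L2_sqr _ Lu).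
by apply: eq_integrable => // x _ /=; congr EFin; ring.
Qed.

Lemma in_L2B u v : in_L2 u -> in_L2 v -> in_L2 (fun x => u x - v x).
Proof.
move=> Lu Lv; have := in_L2D _ _ Lu (in_L2Z (-1) _ Lv).
by congr in_L2; apply/funext => x; rewrite mulN1r.
Qed.

Lemma in_L2_bounded u M : measurable_fun (@unit_itv R) u ->
  (forall x, 0 < x < 1 -> `|u x| <= M) -> in_L2 u.
Proof.
move=> mu uM; split=> //; apply: (integrable01_bounded _ (M ^+ 2)).
  exact: measurable_funX.
by move=> x /uM uxM; rewrite normrX lerXn2r ?nnegrE// (le_trans _ uxM).
Qed.

Lemma in_L2Ml h u M : measurable_fun (@unit_itv R) h ->
  (forall x, 0 < x < 1 -> `|h x| <= M) -> in_L2 u -> in_L2 (fun x => h x * u x).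
Proof.
move=> mh hM Lu; split; first by apply: measurable_funM => //; case: Lu.
have : integrable01 (fun x => h x ^+ 2 * u x ^+ 2).
  apply: (integrable01Ml _ _ (M ^+ 2)) (in_L2_sqr _ Lu); first exact: measurable_funX.
  by move=> x /hM hxM; rewrite normrX lerXn2r ?nnegrE// (le_trans _ hxM).
by apply: eq_integrable => // x _ /=; congr EFin; ring.
Qed.

Lemma in_L2_cst s : in_L2 (fun=> s : R).
Proof. by apply: (in_L2_bounded _ `|s|) => //; exact: measurable_cst. Qed.

Lemma in_L2_integrable01 u : in_L2 u -> integrable01 u.
Proof.
move=> Lu; have := in_L2_integrable01M _ _ (in_L2_cst 1) Lu.
by apply: eq_integrable => // x _ /=; rewrite mul1r.
Qed.

Lemma ipE u v : ip u v = itg (fun x => u x * v x) 0 1.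
Proof. by []. Qed.

Lemma ipC u v : ip u v = ip v u.
Proof. by rewrite !ipE; apply: eq_itg => x _; rewrite mulrC. Qed.

Lemma eq_ip u u' v v' : (forall x, 0 < x < 1 -> u x * v x = u' x * v' x) ->
  ip u v = ip u' v'.
Proof. by move=> uv; rewrite !ipE; exact: eq_itg. Qed.

Lemma ip_ge0 u : 0 <= ip u u.
Proof. by rewrite ipE; apply: itg_ge0 => x _; rewrite -expr2 sqr_ge0. Qed.

Lemma L2normK u : L2norm u ^+ 2 = ip u u.
Proof. by rewrite sqr_sqrtr// ip_ge0. Qed.

Lemma ipDl u v w : in_L2 u -> in_L2 v -> in_L2 w ->
  ip (fun x => u x + v x) w = ip u w + ip v w.
Proof.
move=> Lu Lv Lw; rewrite !ipE -itgD//; try exact: in_L2_integrable01M.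
by apply: eq_itg => x _; rewrite mulrDl.
Qed.

Lemma ipZl s u w : in_L2 u -> in_L2 w -> ip (fun x => s * u x) w = s * ip u w.
Proof.
move=> Lu Lw; rewrite !ipE -itgZ//; try exact: in_L2_integrable01M.
by apply: eq_itg => x _; rewrite mulrA.
Qed.

Lemma ipBl u v w : in_L2 u -> in_L2 v -> in_L2 w ->
  ip (fun x => u x - v x) w = ip u w - ip v w.
Proof.
move=> Lu Lv Lw; rewrite !ipE -itgB//; try exact: in_L2_integrable01M.
by apply: eq_itg => x _; rewrite mulrBl.
Qed.

Lemma ipBr u v w : in_L2 u -> in_L2 v -> in_L2 w ->
  ip w (fun x => u x - v x) = ip w u - ip w v.
Proof. by move=> Lu Lv Lw; rewrite ipC ipBl// [ip u _]ipC [ip v _]ipC. Qed.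

Lemma ipDr u v w : in_L2 u -> in_L2 v -> in_L2 w ->
  ip w (fun x => u x + v x) = ip w u + ip w v.
Proof. by move=> Lu Lv Lw; rewrite ipC ipDl// [ip u _]ipC [ip v _]ipC. Qed.

Lemma ipZr s u w : in_L2 u -> in_L2 w -> ip w (fun x => s * u x) = s * ip w u.
Proof. by move=> Lu Lw; rewrite ipC ipZl// ipC. Qed.

(** The parameter s is chosen to match the weights of the terms that absorb. *)
Lemma ip_young s u v : 0 < s -> in_L2 u -> in_L2 v ->
  2 * ip u v <= s * ip u u + s^-1 * ip v v.
Proof.
move=> s0 Lu Lv; have Lsu := in_L2Z s _ Lu.
have := ip_ge0 (fun x => s * u x - v x).
have Lw := in_L2B _ _ Lsu Lv.
rewrite ipBl// !ipBr// !ipZl// !ipZr// [ip v u]ipC => H.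
suff : 0 <= s^-1 * (s * (s * ip u u) - s * ip u v - (s * ip u v - ip v v)).
  rewrite (_ : s^-1 * _ = s * ip u u + s^-1 * ip v v - 2 * ip u v) ?subr_ge0//.
  by field; rewrite gt_eqF.
by rewrite mulr_ge0// invr_ge0 ltW.
Qed.

Lemma ip_youngN s u v : 0 < s -> in_L2 u -> in_L2 v ->
  - (2 * ip u v) <= s * ip u u + s^-1 * ip v v.
Proof.
move=> s0 Lu Lv; have := ip_young _ _ _ s0 (in_L2Z (-1) _ Lu) Lv.
by rewrite ipZl// ipZl//; [rewrite ipZr//; lra|exact: in_L2Z].
Qed.

End L2.

(** * The finite element spaces on the uniform mesh *)

Section Mesh.
Context {R : realType}.
Variables (n : nat) (n_gt0 : (0 < n)%N).
Implicit Types (f u v w q : R -> R) (i m : nat) (s : R).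

Local Notation x_ := (@node R n).

Lemma node0 : x_ 0 = 0. Proof. by rewrite /node mul0r. Qed.

Lemma noden : x_ n = 1. Proof. by rewrite /node divff// pnatr_eq0 -lt0n. Qed.

Lemma node_step i : x_ i.+1 = x_ i + n%:R^-1.
Proof. by rewrite /node -natr1 mulrDl mul1r. Qed.

Lemma node_ltS i : x_ i < x_ i.+1.
Proof. by rewrite node_step ltrDl invr_gt0 ltr0n. Qed.

Lemma node_le i j : (i <= j)%N -> x_ i <= x_ j.
Proof. by move=> ij; rewrite ler_pM2r ?invr_gt0 ?ltr0n// ler_nat. Qed.

Lemma node_ge0 i : 0 <= x_ i.
Proof. by rewrite -node0 node_le. Qed.

Lemma node_le1 i : (i <= n)%N -> x_ i <= 1.
Proof. by rewrite -noden; exact: node_le. Qed.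

Lemma itg_elements f : integrable01 f ->
  itg f 0 1 = \sum_(i < n) itg f (x_ i) (x_ i.+1).
Proof.
move=> ff; rewrite -noden.
suff H m : (m <= n)%N -> itg f 0 (x_ m) = \sum_(i < m) itg f (x_ i) (x_ i.+1).
  exact: H.
elim: m => [_|m IH mn].
  by rewrite big_ord0 node0 itg_ge.
rewrite big_ord_recr/= -IH 1?ltnW// -itg_split//.
- exact: node_ge0.
- exact: node_le.
- exact: node_le1.
Qed.

Lemma ip_elements u v : in_L2 u -> in_L2 v ->
  ip u v = \sum_(i < n) itg (fun x => u x * v x) (x_ i) (x_ i.+1).
Proof. by move=> Lu Lv; rewrite ipE itg_elements//; exact: in_L2_integrable01M. Qed.

(** Free at the nodes and possibly discontinuous there: a common superspace of
    Q_h and V_h, in which measurability and boundedness are proved once. *)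
Definition piecewise_affine u := forall i, (i < n)%N ->
  exists c d : R, forall x, x_ i < x < x_ i.+1 -> u x = c + d * x.

Lemma Qh_piecewise_affine q : Qh n q -> piecewise_affine q.
Proof.
move=> Qq i /Qq[c qc]; exists c, 0 => x xi.
by rewrite qc ?in_itv// mul0r addr0.
Qed.

Lemma Vh_piecewise_affine v : Vh n v -> piecewise_affine v.
Proof.
move=> [_ Vv] i /Vv[c [d vcd]]; exists c, d => x /andP[xi xi1].
by rewrite vcd// in_itv/= !ltW.
Qed.

Lemma piecewise_affine_in_L2 u : piecewise_affine u -> in_L2 u.
Proof.
move=> pu.
have H m : (m <= n)%N -> measurable_fun (`[0, x_ m[%classic : set R) u /\
    exists M : R, forall x : R, 0 <= x < x_ m -> `|u x| <= M.
  elim: m => [_|m IH mn].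
    rewrite node0 set_itvco0; split; first exact: measurable_fun_set0.
    by exists 0 => x /andP[x0 /(le_lt_trans x0)]; rewrite ltxx.
  have [mu [M uM]] := IH (ltnW mn).
  have [c [d ucd]] := pu m mn; split.
    have -> : `[0, x_ m.+1[%classic =
        `[0, x_ m[ `|` ([set x_ m] `|` `]x_ m, x_ m.+1[) :> set R.
      apply/seteqP; split=> x /=; rewrite !in_itv/=.
        move=> /andP[x0 xm1]; have [xm|xm|xm] := ltgtP x (x_ m).
        - by left; rewrite x0.
        - by right; right.
        - by right; left.
      have := node_ltS m; have := node_ge0 m.
      move=> x0 xS [/andP[-> xm]|[->|]]; first by rewrite (lt_trans xm).
        by rewrite x0.
      by move=> /andP[/ltW xm ->]; rewrite (le_trans x0).
    apply/measurable_funU => //; first exact: measurableU.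
    split=> //; apply/measurable_funU => //; split; first exact: measurable_fun_set1.
    apply: (eq_measurable_fun (fun x => c + d * x)).
      by move=> x; rewrite inE/= in_itv/= => xm; rewrite ucd.
    by apply: measurable_funTS; apply: measurable_funD => //; exact: measurable_funM.
  exists (Num.max M (Num.max `|u (x_ m)| (`|c| + `|d|))) => x /andP[x0 xm1].
  rewrite !le_max; have [xm|xm|->] := ltgtP x (x_ m).
  - by rewrite uM ?x0.
  - apply/orP; right; apply/orP; right.
    rewrite ucd ?xm// (le_trans (ler_normD _ _))// lerD2l normrM [`|x|]ger0_norm//.
    by rewrite ler_piMr// ltW// (lt_le_trans xm1)// node_le1.
  - by rewrite lexx orbT.
have [mu [M uM]] := H n (leqnn n); rewrite noden in mu uM.
apply: (in_L2_bounded _ M).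
  by apply: measurable_funS mu => //; apply: subset_itvr; rewrite bnd_simp.
by move=> x /andP[/ltW x0 x1]; rewrite uM ?x0.
Qed.

Lemma Qh_in_L2 q : Qh n q -> in_L2 q.
Proof. by move=> /Qh_piecewise_affine/piecewise_affine_in_L2. Qed.

Lemma Vh_in_L2 v : Vh n v -> in_L2 v.
Proof. by move=> /Vh_piecewise_affine/piecewise_affine_in_L2. Qed.

Lemma affine_derive1 v a b (c d x : R) :
  (forall y, a < y < b -> v y = c + d * y) -> a < x < b -> derive1 v x = d.
Proof.
move=> vcd xab.
have -> : derive1 v x = derive1 (fun y : R => c + d * y) x.
  rewrite !derive1E; apply: near_eq_derive => //.
  have : x \in `]a, b[ by rewrite in_itv.
  move=> /near_in_itvoo; apply: filterS => y; rewrite in_itv/=; exact: vcd.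
rewrite derive1E deriveD//.
by rewrite derive_cst add0r deriveM// derive_cst derive_id scaler0 addr0 scaler1.
Qed.

Lemma Vh_element v i : Vh n v -> (i < n)%N -> exists c d : R,
  (forall x, x_ i <= x <= x_ i.+1 -> v x = c + d * x) /\
  (forall x, x_ i < x < x_ i.+1 -> derive1 v x = d).
Proof.
move=> [_ Vv] lin; have [c [d vcd]] := Vv i lin; exists c, d; split.
  by move=> x xi; rewrite vcd.
move=> x; apply: affine_derive1 => y /andP[xy yx].
by rewrite vcd// in_itv/= !ltW.
Qed.

Lemma derive1_Vh v : Vh n v -> Qh n (derive1 v).
Proof.
by move=> Vv i /(Vh_element _ _ Vv)[_ [d [_ vd]]]; exists d => x; rewrite in_itv; exact: vd.
Qed.

Lemma derive1_Vh_in_L2 v : Vh n v -> in_L2 (derive1 v).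
Proof. by move=> Vv; exact/Qh_in_L2/derive1_Vh. Qed.

Lemma Vh_diffq s v w : Vh n v -> Vh n w -> Vh n (fun x => (v x - w x) / s).
Proof.
move=> [cv Vv] [cw Vw]; split.
  by move=> x; apply: cvgM; [apply: cvgB; [exact: cv|exact: cw]|exact: cvg_cst].
move=> i lin; have [c [d vcd]] := Vv i lin; have [c' [d' wcd]] := Vw i lin.
exists ((c - c') / s), ((d - d') / s) => x xi; rewrite vcd// wcd//; ring.
Qed.

Lemma Qh_diffq s q q' : Qh n q -> Qh n q' -> Qh n (fun x => (q x - q' x) / s).
Proof.
move=> Qq Qq' i lin; have [c qc] := Qq i lin; have [c' qc'] := Qq' i lin.
by exists ((c - c') / s) => x xi; rewrite qc// qc'.
Qed.

Lemma Vh_sub v w : Vh n v -> Vh n w -> Vh n (v \- w).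
Proof.
move=> Vv Vw; have := Vh_diffq 1 _ _ Vv Vw.
by congr (Vh n _); apply/funext => x; rewrite divr1.
Qed.

Lemma Qh_sub v w : Qh n v -> Qh n w -> Qh n (v \- w).
Proof.
move=> Vv Vw; have := Qh_diffq 1 _ _ Vv Vw.
by congr (Qh n _); apply/funext => x; rewrite divr1.
Qed.

Lemma ip_diffq s u v w : in_L2 u -> in_L2 v -> in_L2 w ->
  ip (fun x => (v x - w x) / s) u = (ip v u - ip w u) / s.
Proof.
move=> Lu Lv Lw; rewrite mulrC -ipBl// -ipZl//; last exact: in_L2B.
by apply: eq_ip => x _; rewrite [_ / s]mulrC.
Qed.

Lemma ip_derive1_diffq s u v w : in_L2 u -> Vh n v -> Vh n w ->
  ip (derive1 (fun x => (v x - w x) / s)) u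
    = (ip (derive1 v) u - ip (derive1 w) u) / s.
Proof.
move=> Lu Vv Vw.
have Lv' := derive1_Vh_in_L2 _ Vv; have Lw' := derive1_Vh_in_L2 _ Vw.
rewrite -(ip_diffq s u _ _ Lu Lv' Lw').
have Vd := Vh_diffq s _ _ Vv Vw.
have Ld : in_L2 (fun x => (derive1 v x - derive1 w x) / s).
  exact: Qh_in_L2 _ (Qh_diffq s _ _ (derive1_Vh _ Vv) (derive1_Vh _ Vw)).
rewrite (ip_elements _ _ (derive1_Vh_in_L2 _ Vd) Lu) (ip_elements _ _ Ld Lu).
apply: eq_bigr => i _; apply: eq_itg => x xi; congr (_ * _).
have [c [d [vcd vd]]] := Vh_element _ _ Vv (ltn_ord i).
have [c' [d' [wcd wd]]] := Vh_element _ _ Vw (ltn_ord i).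
rewrite vd// wd//; apply: (affine_derive1 _ _ _ ((c - c') / s) _ _ _ xi).
by move=> y /andP[/ltW xy /ltW yx]; rewrite vcd ?xy// wcd ?xy//; ring.
Qed.

Lemma ip_derive1_sub u v w : in_L2 u -> Vh n v -> Vh n w ->
  ip (derive1 (v \- w)) u = ip (derive1 v) u - ip (derive1 w) u.
Proof.
move=> Lu Vv Vw; rewrite -[RHS]divr1 -(ip_derive1_diffq 1 _ _ _ Lu Vv Vw).
suff -> : v \- w = (fun x => (v x - w x) / 1) by [].
by apply/funext => x; rewrite divr1.
Qed.

End Mesh.

(** * A continuously differentiable step function *)

Section SmoothStep.
Context {R : realType}.
Implicit Types (x y z t r : R).

Definition pospart z : R := (z + `|z|) / 2.
Definition half_sqr_pospart z : R := (z ^+ 2 + z * `|z|) / 4.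

(** At 0 the difference quotient is |t|, which is continuous. *)
Lemma is_derive_mulr_norm z : is_derive z 1 (fun t : R => t * `|t|) (2 * `|z|).
Proof.
have [z0|z0|->] := ltgtP z 0.
- have D : is_derive z 1 (fun t : R => - (t ^+ 2)) (2 * `|z|).
    by apply: is_derive_eq; rewrite /GRing.scale/= ltr0_norm//; ring.
  apply: near_eq_is_derive D.
  near=> t; have t0 : t < 0 by near: t; exact: lt_nbhsl.
  by rewrite ltr0_norm//; ring.
- have D : is_derive z 1 (fun t : R => t ^+ 2) (2 * `|z|).
    by apply: is_derive_eq; rewrite /GRing.scale/= gtr0_norm//; ring.
  apply: near_eq_is_derive D.
  near=> t; have t0 : 0 < t by near: t; exact: lt_nbhsr.
  by rewrite gtr0_norm//; ring.
- apply/is_derive1_caratheodory; exists (fun t => `|t|); split.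
  + by move=> t; rewrite !mul0r !subr0 mulrC.
  + exact: norm_continuous.
  + by rewrite normr0 mulr0.
Unshelve. all: by end_near. Qed.

Lemma is_derive_half_sqr_pospart z :
  is_derive z 1 half_sqr_pospart (pospart z).
Proof.
have D := is_derive_mulr_norm z.
rewrite /half_sqr_pospart; apply: is_derive_eq.
by rewrite /pospart /GRing.scale/=; field.
Qed.

Lemma pospart_continuous : continuous pospart.
Proof.
move=> z; apply: cvgM; last exact: cvg_cst.
by apply: cvgD; [exact: cvg_id|exact: norm_continuous].
Qed.

(** Second differences turn the quadratic spline into a C^1 step from 0 to 1 and
    its derivative into a hat function. *)
Definition step z : R :=
  half_sqr_pospart (z + 1) - 2 * half_sqr_pospart z + half_sqr_pospart (z - 1).
Definition hat z : R := pospart (z + 1) - 2 * pospart z + pospart (z - 1).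

Lemma is_derive_step z : is_derive z 1 step (hat z).
Proof.
have D0 := is_derive_half_sqr_pospart z.
have D1 : is_derive z 1 (half_sqr_pospart \o (fun t => t + 1)) (pospart (z + 1) * 1).
  have := is_derive_half_sqr_pospart (z + 1) => D.
  apply: is_derive1_comp; apply: is_derive_eq; exact: addr0.
have D2 : is_derive z 1 (half_sqr_pospart \o (fun t => t - 1)) (pospart (z - 1) * 1).
  have := is_derive_half_sqr_pospart (z - 1) => D.
  apply: is_derive1_comp; apply: is_derive_eq; exact: subr0.
rewrite /= in D1 D2; apply: is_derive_eq.
by rewrite /hat /GRing.scale/=; ring.
Qed.

Lemma hat_continuous : continuous hat.
Proof.
have c s : continuous (fun z => pospart (z + s)).
  move=> z; apply: (@continuous_comp _ _ _ (fun z => z + s) pospart).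
    by apply: cvgD; [exact: cvg_id|exact: cvg_cst].
  exact: pospart_continuous.
move=> z; apply: cvgD; last exact: c.
apply: cvgB; first exact: c.
by apply: cvgM; [exact: cvg_cst|exact: pospart_continuous].
Qed.

Lemma step_le z : z <= -1 -> step z = 0.
Proof.
move=> z1; rewrite /step /half_sqr_pospart !ler0_norm; [by field|lra..].
Qed.

Lemma step_ge z : 1 <= z -> step z = 1.
Proof.
move=> z1; rewrite /step /half_sqr_pospart !ger0_norm; [by field|lra..].
Qed.

Lemma step01 z : 0 <= step z <= 1.
Proof.
have [?|?] := lerP z (-1); first by rewrite step_le// lexx ler01.
have [?|?] := lerP 1 z; first by rewrite step_ge// lexx ler01.
rewrite /step /half_sqr_pospart [`|z + 1|]ger0_norm; last lra.
rewrite [`|z - 1|]ler0_norm; last lra.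
by have [?|?] := ger0P z; apply/andP; split; nra.
Qed.

Lemma hat_out z : 1 <= `|z| -> hat z = 0.
Proof.
rewrite /hat /pospart ler_normr => /orP[z1|z1].
  by rewrite !ger0_norm; [by field|lra..].
by rewrite !ler0_norm; [by field|lra..].
Qed.

Lemma hat01 z : 0 <= hat z <= 1.
Proof.
have [?|?] := lerP 1 `|z|; first by rewrite hat_out// lexx ler01.
have : -1 < z < 1 by rewrite -ltr_norml.
rewrite /hat /pospart => /andP[? ?].
rewrite [`|z + 1|]ger0_norm; last lra.
rewrite [`|z - 1|]ler0_norm; last lra.
by have [?|?] := ger0P z; apply/andP; split; lra.
Qed.

Definition step_at x r t : R := step ((t - x) / r).
Definition hat_at x r t : R := hat ((t - x) / r) / r.

Lemma is_derive_step_at x r t : is_derive t 1 (step_at x r) (hat_at x r t).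
Proof.
have D0 := is_derive_step ((t - x) / r).
apply: (@is_derive1_comp _ step (fun t => (t - x) / r)).
by apply: is_derive_eq; rewrite /GRing.scale/=; ring.
Qed.

Lemma hat_at_continuous x r : continuous (hat_at x r).
Proof.
move=> t; apply: cvgM; last exact: cvg_cst.
apply: (@continuous_comp _ _ _ (fun t => (t - x) / r) hat).
  by apply: cvgM; [apply: cvgB; [exact: cvg_id|exact: cvg_cst]|exact: cvg_cst].
exact: hat_continuous.
Qed.

Lemma step_at_continuous x r : continuous (step_at x r).
Proof.
move=> t; apply: differentiable_continuous; apply/derivable1_diffP.
by have D := is_derive_step_at x r t.
Qed.

Section At.
Variables (x r : R) (r0 : 0 < r).

Lemma step_at_le t : t <= x - r -> step_at x r t = 0.
Proof.
by move=> tx; apply: step_le; rewrite ler_pdivrMr// mulN1r; lra.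
Qed.

Lemma step_at_ge t : x + r <= t -> step_at x r t = 1.
Proof.
by move=> tx; apply: step_ge; rewrite ler_pdivlMr// mul1r; lra.
Qed.

Lemma step_at01 t : 0 <= step_at x r t <= 1.
Proof. exact: step01. Qed.

Lemma hat_at_out t : r <= `|t - x| -> hat_at x r t = 0.
Proof.
move=> tx; rewrite /hat_at hat_out ?mul0r//.
by rewrite normrM normfV [`|r|]gtr0_norm// ler_pdivlMr// mul1r.
Qed.

Lemma hat_at_bounds t : 0 <= hat_at x r t <= r^-1.
Proof.
have /andP[h0 h1] := hat01 ((t - x) / r).
have rV0 : 0 <= r^-1 by rewrite invr_ge0 ltW.
by rewrite /hat_at mulr_ge0//= ler_piMl.
Qed.

End At.
End SmoothStep.

Lemma itg_derive {R : realType} (F f : R -> R) (a b : R) : a <= b ->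
  (forall x : R, is_derive x 1 F (f x)) -> continuous f ->
  itg f a b = F b - F a.
Proof.
move=> ab dF cf; have [->|nab] := eqVneq a b; first by rewrite itg_ge// subrr.
have {nab} ab : a < b by rewrite lt_neqAle nab.
have cF : continuous F.
  move=> x; apply: differentiable_continuous; apply/derivable1_diffP.
  by have D := dF x.
have cw : {within `[a, b], continuous f} by exact: continuous_subspaceT.
have ici : (@leb R).-integrable `[a, b] (EFin \o f).
  by apply: continuous_compact_integrable => //; exact: segment_compact.
have dom : derivable_oo_LRcontinuous F a b.
  split; first by move=> x _; have D := dF x.
    by apply: cvg_at_right_filter; exact: cF.
  by apply: cvg_at_left_filter; exact: cF.
have F' : {in `]a, b[, derive1 F =1 f}.
  by move=> x _; rewrite derive1E; have D := dF x; rewrite derive_val.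
have := continuous_FTC2 ab cw dom F'.
rewrite /itg (@Rintegral_itv_bndo_bndc _ (BRight a)); last first.
  by apply: integrableS ici => //; [exact: measurable_itv..|exact: subset_itv_oo_cc].
rewrite Rintegral_itv_obnd_cbnd; last first.
  by apply: integrableS ici => //; [exact: measurable_itv..|exact: subset_itv_oc_cc].
by rewrite /Rintegral /leb => ->.
Qed.

(** * Weakly differentiable functions are primitives *)

Section WeakDerivative.
Context {R : realType}.
Implicit Types (u : R -> R) (c e r s t x y : R).

(** The function is extended by zero because Lebesgue's differentiation theorem
    is about locally integrable functions on the whole line. *)
Lemma lebesgue_pt_small u x e : integrable01 u -> 0 < x < 1 -> 0 < e ->
  lebesgue_pt (u \_ unit_itv) x ->
  \forall r \near 0^'+, itg (fun t => `|u t - u x|) (x - r) (x + r) <= e * r.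
Proof.
move=> ui x01 e0 ux.
have e20 : (0 < (e / 2)%:E)%E by rewrite lte_fin divr_gt0.
have davg_lt : \forall r \near 0^'+, (davg (u \_ unit_itv) x r < (e / 2)%:E)%E.
  exact: (ux (fun z => z < (e / 2)%:E)%E (open_ereal_lt' e20)).
near=> r; have r0 : 0 < r by near: r; exact: nbhs_right_gt.
have r1 : r < x by near: r; apply: nbhs_right_lt; case/andP: x01.
have r2 : r < 1 - x by near: r; apply: nbhs_right_lt; rewrite subr_gt0; case/andP: x01.
have : (davg (u \_ unit_itv) x r < (e / 2)%:E)%E by near: r.
have iux : integrable01 (fun t => `|u t - u x|).
  by apply: integrable01_norm; apply: integrable01B => //; exact: integrable01_cst.
rewrite /davg /iavg lebesgue_measure_ball ?(ltW r0)// ball_itv.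
rewrite [X in (_ * X)%E](_ : _ =
    (itg (fun t => `|u t - u x|) (x - r) (x + r))%:E); last first.
  rewrite /itg /Rintegral fineK; last first.
    apply: integrable_fin_num => //; apply: integrable01_sub => //; lra.
  apply: eq_integral => t; rewrite inE/= in_itv/= => /andP[tx xt].
  rewrite /patch !mem_set//= /unit_itv/= in_itv/=; apply/andP; split; lra.
rewrite inver mulrn_eq0/= gt_eqF//= -EFinM lte_fin => H; apply: ltW.
move: H; rewrite mulrC ltr_pdivrMr; last by rewrite pmulrn_lgt0.
by rewrite -[r *+ 2]mulr_natr => /lt_le_trans; apply; lra.
Unshelve. all: by end_near. Qed.

(** The hat has mass 1 and is at most 1/r on an interval of length 2r, so the
    error is at most 1/r times the integral of |u - u(x)| over that interval. *)
Lemma hat_mean_near u x e : integrable01 u -> 0 < x < 1 -> 0 < e ->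
  lebesgue_pt (u \_ unit_itv) x ->
  \forall r \near 0^'+, `|itg (fun t => u t * hat_at x r t) 0 1 - u x| <= e.
Proof.
move=> ui x01 e0 ux; near=> r.
have r0 : 0 < r by near: r; exact: nbhs_right_gt.
have r1 : r < x by near: r; apply: nbhs_right_lt; case/andP: x01.
have r2 : r < 1 - x by near: r; apply: nbhs_right_lt; rewrite subr_gt0; case/andP: x01.
have H : itg (fun t => `|u t - u x|) (x - r) (x + r) <= e * r.
  by near: r; exact: lebesgue_pt_small.
have mh : measurable_fun (@unit_itv R) (hat_at x r).
  by apply: measurable_funTS; apply: continuous_measurable_fun; exact: hat_at_continuous.
have hb t : `|hat_at x r t| <= r^-1.
  by have /andP[h0 h1] := hat_at_bounds x r r0 t; rewrite ger0_norm.
have hi v : integrable01 v -> integrable01 (fun t => v t * hat_at x r t).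
  move=> vi; have := integrable01Ml v (hat_at x r) r^-1 mh (fun t _ => hb t) vi.
  by congr integrable01; apply/funext => t; rewrite mulrC.
have h1 : itg (hat_at x r) 0 1 = 1.
  rewrite (itg_derive _ _ _ _ ler01 (is_derive_step_at x r) (hat_at_continuous x r)).
  by rewrite step_at_ge ?step_at_le ?subr0//; lra.
have uxi : integrable01 (fun t => u t - u x).
  by apply: integrable01B => //; exact: integrable01_cst.
have hhi : integrable01 (hat_at x r).
  by have := hi _ (integrable01_cst 1); congr integrable01; apply/funext => t; rewrite mul1r.
have -> : itg (fun t => u t * hat_at x r t) 0 1 - u x
    = itg (fun t => (u t - u x) * hat_at x r t) 0 1.
  rewrite [X in _ - X = _](_ : _ = itg (fun t => u x * hat_at x r t) 0 1).
  rewrite -itgB//; [|exact: hi|exact: integrable01Z].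
    by apply: eq_itg => t _; rewrite mulrBl.
  by rewrite itgZ// h1 mulr1.
apply: le_trans (itg_norm _ _ _ _ _ (hi _ uxi)) _ => //.
have ni := integrable01_norm _ (hi _ uxi).
rewrite (itg_split _ 0 (x - r) 1) ?(itg_split _ (x - r) (x + r) 1)//; try lra.
rewrite [X in X + _](_ : _ = 0); last first.
  rewrite (eq_itg _ (fun=> 0)) ?itg_cst ?mul0r//; first lra.
  by move=> t /andP[_ tx]; rewrite hat_at_out ?mulr0 ?normr0// ler0_norm; lra.
rewrite [X in _ + (_ + X)](_ : _ = 0); last first.
  rewrite (eq_itg _ (fun=> 0)) ?itg_cst ?mul0r//; first lra.
  by move=> t /andP[tx _]; rewrite hat_at_out ?mulr0 ?normr0// ger0_norm; lra.
rewrite add0r addr0.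
have ani := integrable01_norm _ uxi.
apply: (@le_trans _ _ (r^-1 * itg (fun t => `|u t - u x|) (x - r) (x + r))).
  rewrite -itgZ//; try lra.
  apply: le_itg => //; try lra; first exact: integrable01Z.
  by move=> t _; rewrite normrM mulrC ler_wpM2r.
by rewrite mulrC ler_pdivrMr.
Unshelve. all: by end_near. Qed.

(** By Cauchy-Schwarz, uniformly in the position of the interval. *)
Lemma itg_short w e : in_L2 w -> 0 < e ->
  \forall r \near 0^'+, forall a b, 0 <= a -> a <= b -> b <= 1 -> b - a <= r ->
    itg (fun t => `|w t|) a b <= e.
Proof.
move=> Lw e0; pose W := ip w w; have W0 : 0 <= W by exact: ip_ge0.
near=> r => a b a0 ab b1 bar.
have r0 : 0 < r by near: r; exact: nbhs_right_gt.
have rW : r <= e ^+ 2 / (W + 1).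
  near: r; apply: nbhs_right_le; rewrite divr_gt0 ?exprn_gt0//; lra.
have wi := integrable01_norm _ (in_L2_integrable01 _ Lw).
have w2i : integrable01 (fun t => `|w t| ^+ 2).
  have := in_L2_sqr _ Lw; congr integrable01.
  by apply/funext => t; rewrite real_normK ?num_real.
have W2 : itg (fun t => `|w t| ^+ 2) a b <= W.
  rewrite /W ipE (eq_itg (fun t => w t * w t) (fun t => `|w t| ^+ 2)); last first.
    by move=> t _; rewrite real_normK ?num_real.
  rewrite (itg_split _ 0 a 1) ?(itg_split _ a b 1)//; try lra.
  have p c d : 0 <= itg (fun t => `|w t| ^+ 2) c d.
    by apply: itg_ge0 => t _; exact: sqr_ge0.
  by have := p 0 a; have := p b 1; lra.
have := sqr_itg_le _ _ _ a0 ab b1 wi w2i.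
have I0 : 0 <= itg (fun t => `|w t|) a b by apply: itg_ge0.
have I2 : 0 <= itg (fun t => `|w t| ^+ 2) a b.
  by apply: itg_ge0 => t _; exact: sqr_ge0.
move=> H; rewrite -(@ler_pXn2r _ 2) ?nnegrE ?(ltW e0)//.
apply: le_trans H _; apply: (@le_trans _ _ (r * (W + 1))).
  by apply: ler_pM => //; lra.
by rewrite -ler_pdivlMr//; lra.
Unshelve. all: by end_near. Qed.

(** The step and the indicator function of t > x differ by at most 1, and only
    within distance r of x. *)
Lemma step_mean_near w x e : in_L2 w -> 0 < x < 1 -> 0 < e ->
  \forall r \near 0^'+,
    `|itg (fun t => w t * step_at x r t) 0 1 - itg w x 1| <= e.
Proof.
move=> Lw x01 e0; near=> r.
have r0 : 0 < r by near: r; exact: nbhs_right_gt.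
have r1 : r < x by near: r; apply: nbhs_right_lt; case/andP: x01.
have r2 : r < 1 - x by near: r; apply: nbhs_right_lt; rewrite subr_gt0; case/andP: x01.
have H : forall a b, 0 <= a -> a <= b -> b <= 1 -> b - a <= r ->
    itg (fun t => `|w t|) a b <= e / 2.
  by near: r; apply: itg_short => //; rewrite divr_gt0.
have wi := in_L2_integrable01 _ Lw; have ni := integrable01_norm _ wi.
have ms : measurable_fun (@unit_itv R) (step_at x r).
  by apply: measurable_funTS; apply: continuous_measurable_fun; exact: step_at_continuous.
have si : integrable01 (fun t => w t * step_at x r t).
  have := integrable01Ml w (step_at x r) 1 ms; have H1 t : `|step_at x r t| <= 1.
    by have /andP[? ?] := step_at01 x r t; rewrite ger0_norm.
  move=> /(_ (fun t _ => H1 t) wi).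
  by congr integrable01; apply/funext => t; rewrite mulrC.
rewrite (itg_split _ 0 (x - r) 1) ?(itg_split _ (x - r) x 1)//; try lra.
rewrite (itg_split _ x (x + r) 1)// ?(itg_split w x (x + r) 1)//; try lra.
have -> : itg (fun t => w t * step_at x r t) 0 (x - r) = 0.
  rewrite (eq_itg _ (fun=> 0)) ?itg_cst ?mul0r//; first lra.
  by move=> t /andP[_ tx]; rewrite step_at_le ?mulr0//; lra.
have -> : itg (fun t => w t * step_at x r t) (x + r) 1 = itg w (x + r) 1.
  by apply: eq_itg => t /andP[tx _]; rewrite step_at_ge ?mulr1//; lra.
set A := itg _ (x - r) x; set B := itg _ x (x + r); set C := itg w x (x + r).
set D := itg w (x + r) 1.
have -> : 0 + (A + (B + D)) - (C + D) = A + (B - C) by ring.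
have -> : e = e / 2 + e / 2 by lra.
apply: le_trans (ler_normD _ _) _; apply: lerD.
  apply: (@le_trans _ _ (itg (fun t => `|w t|) (x - r) x)); last by apply: H; lra.
  apply: le_trans (itg_norm _ _ _ _ _ si) _; try lra.
  apply: le_itg => //; [lra|lra|exact: integrable01_norm|move=> t _].
  have /andP[? ?] := step_at01 x r t.
  by rewrite normrM [`|step_at _ _ _|]ger0_norm// ler_piMr.
apply: (@le_trans _ _ (itg (fun t => `|w t|) x (x + r))); last by apply: H; lra.
rewrite /B /C -itgB//; try lra.
have di := integrable01B _ _ si wi.
apply: le_trans (itg_norm _ _ _ _ _ di) _; try lra.
apply: le_itg => //; [lra|lra|exact: integrable01_norm|move=> t _].
have /andP[? ?] := step_at01 x r t.
rewrite -{2}[w t]mulr1 -mulrBr normrM ler_piMr// ler0_norm; lra.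
Unshelve. all: by end_near. Qed.

(** The test function is a step up at x followed by a step down at y. *)
Lemma weak_derivative_lebesgue_pts u u' x y : in_L2 u -> in_L2 u' ->
  weak_derivative u u' -> 0 < x -> x < y -> y < 1 ->
  lebesgue_pt (u \_ unit_itv) x -> lebesgue_pt (u \_ unit_itv) y ->
  u y - u x = itg u' x y.
Proof.
move=> Lu Lu' wd x0 xy y1 lx ly.
have x01 : 0 < x < 1 by rewrite x0 (lt_trans xy).
have y01 : 0 < y < 1 by rewrite y1 (lt_trans x0).
have ui := in_L2_integrable01 _ Lu; have u'i := in_L2_integrable01 _ Lu'.
apply/eqP; rewrite -subr_eq0 -normr_le0; apply/ler_addgt0Pr => e e0; rewrite add0r.
have e4 : 0 < e / 4 by rewrite divr_gt0.
have [r] : exists r, [/\ 0 < r, r < x, r < 1 - y &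
   [/\ `|itg (fun t => u t * hat_at x r t) 0 1 - u x| <= e / 4,
       `|itg (fun t => u t * hat_at y r t) 0 1 - u y| <= e / 4,
       `|itg (fun t => u' t * step_at x r t) 0 1 - itg u' x 1| <= e / 4 &
       `|itg (fun t => u' t * step_at y r t) 0 1 - itg u' y 1| <= e / 4]].
  suff H : \forall r \near (0:R)^'+, [/\ 0 < r, r < x, r < 1 - y &
   [/\ `|itg (fun t => u t * hat_at x r t) 0 1 - u x| <= e / 4,
       `|itg (fun t => u t * hat_at y r t) 0 1 - u y| <= e / 4,
       `|itg (fun t => u' t * step_at x r t) 0 1 - itg u' x 1| <= e / 4 &
       `|itg (fun t => u' t * step_at y r t) 0 1 - itg u' y 1| <= e / 4]].
    exact: filter_ex H.
  near=> r; split; [| | |split]; near: r.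
  - exact: nbhs_right_gt.
  - exact: nbhs_right_lt.
  - by apply: nbhs_right_lt; rewrite subr_gt0.
  - exact: hat_mean_near.
  - exact: hat_mean_near.
  - exact: step_mean_near.
  - exact: step_mean_near.
move=> [r0 rx ry [Hx Hy Sx Sy]].
pose phi t := step_at x r t - step_at y r t.
have dphi t : is_derive t 1 phi (hat_at x r t - hat_at y r t).
  have D1 := is_derive_step_at x r t; have D2 := is_derive_step_at y r t.
  exact: is_deriveB.
have phi' : derive1 phi = fun t => hat_at x r t - hat_at y r t.
  by apply/funext => t; rewrite derive1E; have D := dphi t; rewrite derive_val.
have tphi : test_function phi.
  split; first by move=> t; have D := dphi t.
    by rewrite phi' => t; apply: cvgB; exact: hat_at_continuous.
  exists `[x - r, y + r]%classic; split; first exact: segment_compact.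
    by apply: subset_itv; rewrite bnd_simp; lra.
  move=> t /=; rewrite in_itv/= => /negP; rewrite negb_and -!ltNge => /orP[tx|tx].
    by rewrite /phi !step_at_le ?subrr//; lra.
  by rewrite /phi !step_at_ge ?subrr//; lra.
have Lh z : in_L2 (hat_at z r).
  apply: (in_L2_bounded _ r^-1).
    by apply: measurable_funTS; apply: continuous_measurable_fun; exact: hat_at_continuous.
  by move=> t _; have /andP[? ?] := hat_at_bounds z r r0 t; rewrite ger0_norm.
have Ls z : in_L2 (step_at z r).
  apply: (in_L2_bounded _ 1).
    by apply: measurable_funTS; apply: continuous_measurable_fun; exact: step_at_continuous.
  by move=> t _; have /andP[? ?] := step_at01 z r t; rewrite ger0_norm.
have := wd _ tphi; rewrite phi' ipBr// /phi ipBr// !ipE => E.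
move: Hx Hy Sx Sy.
rewrite (itg_split u' x y 1 (ltW x0) (ltW xy) (ltW y1) (lexx _) u'i) !ler_norml.
move=> /andP[? ?] /andP[? ?] /andP[? ?] /andP[? ?]; apply/andP; split; lra.
Unshelve. all: by end_near. Qed.

Lemma ae_leb_imply (P Q : R -> Prop) : (forall x, P x -> Q x) ->
  {ae @leb R, forall x, P x} -> {ae @leb R, forall x, Q x}.
Proof.
by move=> PQ [N [mN N0 sN]]; exists N; split=> // x nQ; apply: sN => Px; exact/nQ/PQ.
Qed.

Lemma ae_leb_and (P Q : R -> Prop) :
  {ae @leb R, forall x, P x} -> {ae @leb R, forall x, Q x} ->
  {ae @leb R, forall x, P x /\ Q x}.
Proof.
move=> aeP aeQ; have := negligibleU aeP aeQ; apply: negligibleS => x /= nPQ.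
by have [Px|nPx] := pselect (P x); [right => Qx; exact: nPQ|left].
Qed.

Lemma ae_ex (P : R -> Prop) (a b : R) : 0 <= a -> a < b -> b <= 1 ->
  {ae @leb R, forall x, unit_itv x -> P x} -> exists x, a < x < b /\ P x.
Proof.
move=> a0 ab b1 [N [mN N0 sN]]; apply: contrapT => nP.
have abN : `]a, b[%classic `<=` N.
  move=> x /=; rewrite in_itv/= => xab; apply: sN => /= H; apply: nP; exists x.
  split=> //; apply: H; rewrite /unit_itv/= in_itv/=.
  by case/andP: xab => ax xb; apply/andP; split; lra.
have := le_measure (@leb R) _ _ abN; rewrite !inE => /(_ (measurable_oo a b) mN).
have ab' : (a%:E < b%:E)%E by rewrite lte_fin.
rewrite [X in (X <= _)%E](_ : _ = (b - a)%:E); last first.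
  by have := lebesgue_measure_itv `]a, b[; rewrite /= ab'.
rewrite [X in (_ <= X)%E](_ : _ = 0%E); last exact: N0.
by rewrite lee_fin leNgt subr_gt0 ab.
Qed.

(** Almost every point is a Lebesgue point, so one of them can serve as base
    point for all the others. *)
Lemma weak_derivative_primitive u u' : in_L2 u -> in_L2 u' ->
  weak_derivative u u' ->
  exists c, ae_eq (@leb R) unit_itv u (fun x => c + itg u' 0 x).
Proof.
move=> Lu Lu' wd; have ui := in_L2_integrable01 _ Lu; have u'i := in_L2_integrable01 _ Lu'.
pose P x := lebesgue_pt (u \_ unit_itv) x.
have aeP : {ae @leb R, forall x, P x}.
  exact: lebesgue_differentiation (integrable_locally_restrict measurable_unit_itv ui).
have [x0 [x01 Px0]] : exists x0, 0 < x0 < 1 /\ P x0.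
  by apply: (ae_ex P 0 1) => //; apply: ae_leb_imply aeP => x Px _.
exists (u x0 - itg u' 0 x0); apply: ae_leb_imply aeP => x Px.
rewrite /unit_itv/= in_itv/= => x1.
case/andP: x01 => ? ?; case/andP: x1 => ? ?.
have [xx|xx|->] := ltgtP x x0.
- have E : u x0 - u x = itg u' x x0 by exact: weak_derivative_lebesgue_pts.
  have S : itg u' 0 x0 = itg u' 0 x + itg u' x x0 by apply: itg_split => //; lra.
  lra.
- have E : u x - u x0 = itg u' x0 x by exact: weak_derivative_lebesgue_pts.
  have S : itg u' 0 x = itg u' 0 x0 + itg u' x0 x by apply: itg_split => //; lra.
  lra.
- by ring.
Qed.

End WeakDerivative.

(** * Primitives of square integrable functions *)

Section Primitive.
Context {R : realType}.
Implicit Types (u v w : R -> R) (a b c d s x y t : R).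

(** Summing the bound over N equal pieces gives a total of order 1/N. This
    replaces an exchange of integrals in the integration by parts below. *)
Lemma eq_of_small_increments (G Phi : R -> R) a b : a <= b ->
  (forall x y, a <= x -> x <= y -> y <= b ->
    `|G y - G x| <= (y - x) * (Phi y - Phi x)) -> G a = G b.
Proof.
move=> ab H; pose K := (b - a) * (Phi b - Phi a).
have HN (N : nat) : (0 < N)%N -> N%:R * `|G b - G a| <= K.
  move=> N0; have N0R : 0 < N%:R :> R by rewrite ltr0n.
  pose h := (b - a) / N%:R; have h0 : 0 <= h by rewrite divr_ge0// subr_ge0.
  have hN : h * N%:R = b - a by rewrite /h divfK// gt_eqF.
  have step i : (i <= N)%N ->
      `|G (a + h * i%:R) - G a| <= h * (Phi (a + h * i%:R) - Phi a).
    elim: i => [|i IH iN]; first by rewrite mulr0 addr0 !subrr normr0 mulr0.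
    have hi0 : 0 <= h * i%:R by rewrite mulr_ge0.
    have hiN : h * i.+1%:R <= b - a by rewrite -hN ler_wpM2l// ler_nat.
    have hS : h * i.+1%:R = h * i%:R + h by rewrite -natr1 mulrDr mulr1.
    have := H (a + h * i%:R) (a + h * i.+1%:R).
    rewrite (_ : a + h * i.+1%:R - (a + h * i%:R) = h); last by rewrite hS; ring.
    have := IH (ltnW iN).
    set x := a + h * i%:R; set y := a + h * i.+1%:R => IH' /(_ _ _ _)-H'.
    have {}H' : `|G y - G x| <= h * (Phi y - Phi x) by apply: H'; rewrite /x /y; lra.
    have -> : G y - G a = (G y - G x) + (G x - G a) by ring.
    by apply: le_trans (ler_normD _ _) _; lra.
  have := step N (leqnn N); rewrite hN (_ : a + (b - a) = b); last by ring.
  move=> /(ler_wpM2l (ltW N0R)) /le_trans; apply.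
  by rewrite /K -hN; rewrite le_eqVlt; apply/orP; left; apply/eqP; ring.
apply/eqP; rewrite eq_sym -subr_eq0 -normr_eq0; apply/eqP/le_anti.
rewrite normr_ge0 andbT leNgt; apply/negP => G0.
have := HN (Num.truncn (K / `|G b - G a|)).+1 isT.
by rewrite -ler_pdivlMr// leNgt truncnS_gt.
Qed.

Definition primitive c w x := c + itg w 0 x.

Section Continuity.
Variables (c : R) (w : R -> R) (Lw : in_L2 w).
Let wi : integrable01 w := in_L2_integrable01 _ Lw.
Local Notation F := (primitive c w).

Lemma primitiveB x y : 0 <= x -> x <= y -> y <= 1 -> F y - F x = itg w x y.
Proof.
move=> x0 xy y1; rewrite /primitive (itg_split _ 0 x y)//; ring.
Qed.

Lemma primitive_near (e : R) : 0 < e -> exists r : R, 0 < r /\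
  forall x y, 0 <= x <= 1 -> 0 <= y <= 1 -> `|x - y| <= r -> `|F x - F y| <= e.
Proof.
move=> e0; have [r [r0 H]] : exists r : R, 0 < r /\
    forall a b, 0 <= a -> a <= b -> b <= 1 -> b - a <= r ->
      itg (fun t => `|w t|) a b <= e.
  suff : \forall r \near (0:R)^'+, 0 < r /\
      forall a b, 0 <= a -> a <= b -> b <= 1 -> b - a <= r ->
      itg (fun t => `|w t|) a b <= e by exact: filter_ex.
  near=> r; split; near: r; [exact: nbhs_right_gt|exact: itg_short].
exists r; split=> //.
have K x y : 0 <= x <= 1 -> 0 <= y <= 1 -> x <= y -> `|x - y| <= r -> `|F x - F y| <= e.
  move=> /andP[x0 x1] /andP[y0 y1] xy xyr.
  rewrite distrC primitiveB//; apply: le_trans (itg_norm _ _ _ _ _ wi) _ => //.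
  by apply: H => //; move: xyr; rewrite ler_norml => /andP[? ?]; lra.
move=> x y xI yI xyr; have [xy|/ltW yx] := leP x y; first exact: K.
by rewrite distrC; apply: K => //; rewrite distrC.
Unshelve. all: by end_near. Qed.

Lemma primitive_in_L2 : in_L2 F.
Proof.
(* F composed with clamp is continuous on the whole line, hence measurable *)
pose clamp x : R := Num.max 0 (Num.min 1 x).
have clamp01 x : 0 <= clamp x <= 1.
  by rewrite /clamp le_max lexx/= ge_max ler01 ge_min lexx.
have clampE x : 0 <= x <= 1 -> clamp x = x.
  by move=> /andP[x0 x1]; rewrite /clamp min_r// max_r.
have clampB x y : `|clamp x - clamp y| <= `|x - y|.
  rewrite /clamp.
  have := ler_norm (x - y); have := ler_norm (- (x - y)); rewrite normrN ler_norml.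
  move=> xy yx; have [?|?] := leP 1 x; have [?|?] := leP 1 y; rewrite ?(max_r ler01).
  - by apply/andP; split; lra.
  - by have [?|?] := leP 0 y; apply/andP; split; lra.
  - by have [?|?] := leP 0 x; apply/andP; split; lra.
  - by have [?|?] := leP 0 x; have [?|?] := leP 0 y; apply/andP; split; lra.
have cG : continuous (F \o clamp).
  move=> x; apply/cvgrPdist_le => /= e e0.
  have [r [r0 H]] := primitive_near e e0; near=> y.
  apply: H => //; apply: le_trans (clampB _ _) _.
  by near: y; apply: (@cvgr_dist_le _ _ _ (nbhs x) _ id x) => //; exact: cvg_id.
have [r [r0 H]] := primitive_near 1 ltr01.
apply: (in_L2_bounded _ (`|c| + itg (fun t => `|w t|) 0 1)).
  apply: (eq_measurable_fun (F \o clamp)).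
    move=> x; rewrite inE/= /unit_itv/= in_itv/= => /andP[/ltW x0 /ltW x1].
    by rewrite /= clampE ?x0.
  by apply: measurable_funTS; exact: continuous_measurable_fun.
move=> x /andP[/ltW x0 /ltW x1]; apply: le_trans (ler_normD _ _) _; rewrite lerD2l.
apply: le_trans (itg_norm _ _ _ _ _ wi) _ => //.
rewrite (itg_split _ 0 x 1)//; last exact: integrable01_norm.
by rewrite lerDl; apply: itg_ge0.
Unshelve. all: by end_near. Qed.

Lemma primitive_sqrB x y : 0 <= x -> x <= y -> y <= 1 ->
  (F y - F x) ^+ 2 <= (y - x) * itg (fun t => w t ^+ 2) x y.
Proof.
by move=> x0 xy y1; rewrite primitiveB//; apply: sqr_itg_le => //; exact: in_L2_sqr.
Qed.

(** The defect of the formula on [x, y] is at most 2 |d| (y - x) times the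
    integral of |w| over [x, y]. *)
Lemma primitive_by_parts (c' d a b : R) : 0 <= a -> a <= b -> b <= 1 ->
  itg (fun t => F t * d + w t * (c' + d * t)) a b
    = F b * (c' + d * b) - F a * (c' + d * a).
Proof.
move=> a0 ab b1; pose f t := F t * d + w t * (c' + d * t).
have Fi := in_L2_integrable01 _ primitive_in_L2.
have ma (k l : R) : measurable_fun (@unit_itv R) (fun t => k + l * t).
  by apply: measurable_funTS; apply: measurable_funD => //; exact: measurable_funM.
have ba (k l : R) t : 0 < t < 1 -> `|k + l * t| <= `|k| + `|l|.
  move=> /andP[t0 t1]; apply: le_trans (ler_normD _ _) _; rewrite lerD2l normrM.
  by rewrite ler_piMr// ger0_norm ltW.
have wai k l : integrable01 (fun t => w t * (k + l * t)).
  have := integrable01Ml w (fun t => k + l * t) _ (ma k l) (ba k l) wi.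
  by congr integrable01; apply/funext => t; rewrite mulrC.
have Fdi : integrable01 (fun t => F t * d).
  by have := integrable01Z d _ Fi; congr integrable01; apply/funext => t; rewrite mulrC.
have fi : integrable01 f by exact: integrable01D.
have ni := integrable01_norm _ wi.
pose G x := itg f 0 x - F x * (c' + d * x).
pose Phi x := 2 * `|d| * itg (fun t => `|w t|) 0 x.
suff : G a = G b.
  by rewrite /G (itg_split f 0 a b)//; rewrite -/f => E; lra.
apply: (eq_of_small_increments G Phi) => // x y ax xy yb.
have x0 : 0 <= x by lra.
have y1 : y <= 1 by lra.
have Fxy := primitiveB x y x0 xy y1.
have -> : Phi y - Phi x = 2 * `|d| * itg (fun t => `|w t|) x y.
  by rewrite /Phi (itg_split _ 0 x y)//; ring.
pose g1 t := (F t - F x) * d.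
pose g2 t := w t * (- (d * y) + d * t).
have g1i : integrable01 g1.
  have := integrable01Z d _ (integrable01B _ _ Fi (integrable01_cst (F x))).
  by congr integrable01; apply/funext => t; rewrite mulrC.
have g2i : integrable01 g2 by exact: wai.
have -> : G y - G x = itg (fun t => g1 t + g2 t) x y.
  have E : itg f x y = itg (fun t => g1 t + g2 t) x y
      + (F x * d * (y - x) + (c' + d * y) * itg w x y).
    rewrite -itg_cst// -itgZ// -itgD//; [|exact: integrable01_cst|exact: integrable01Z].
    rewrite -itgD//; [|exact: integrable01D|].
      by apply: eq_itg => t _; rewrite /f /g1 /g2; ring.
    exact: integrable01D (integrable01_cst _) (integrable01Z _ _ wi).
  rewrite /G (itg_split f 0 x y)// E -Fxy; ring.
have g12 := integrable01D _ _ g1i g2i.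
apply: le_trans (itg_norm _ _ x0 y1 _ g12) _.
set I := itg (fun t => `|w t|) x y.
have bi : integrable01 (fun t => `|d| * I + (`|d| * (y - x)) * `|w t|).
  by apply: integrable01D; [exact: integrable01_cst|exact: integrable01Z].
apply: (@le_trans _ _ (itg (fun t => `|d| * I + (`|d| * (y - x)) * `|w t|) x y)).
  apply: le_itg => //; first exact: integrable01_norm.
  move=> t /andP[/ltW xt /ltW ty]; apply: le_trans (ler_normD _ _) _; apply: lerD.
    rewrite /g1 normrM mulrC ler_wpM2l// primitiveB//; last lra.
    apply: le_trans (itg_norm _ _ _ _ _ wi) _ => //; first lra.
    by rewrite /I (itg_split _ x t y)// lerDl; apply: itg_ge0.
  rewrite /g2 normrM mulrC ler_wpM2r//.
  rewrite (_ : - (d * y) + d * t = d * - (y - t)); last by ring.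
  by rewrite normrM normrN ler_wpM2l// ger0_norm; lra.
rewrite itgD//; [|exact: integrable01_cst|exact: integrable01Z].
by rewrite itg_cst// itgZ// -/I; rewrite le_eqVlt; apply/orP; left; apply/eqP; ring.
Qed.

End Continuity.

Lemma ae_eq_ip u u' v : in_L2 u -> in_L2 u' -> in_L2 v ->
  ae_eq (@leb R) unit_itv u u' -> ip u v = ip u' v.
Proof.
move=> Lu Lu' Lv uu'; rewrite /ip /Rintegral; congr fine.
apply: ae_eq_integral => //.
- by apply: measurable_int; exact: (in_L2_integrable01M _ _ Lu Lv).
- by apply: measurable_int; exact: (in_L2_integrable01M _ _ Lu' Lv).
- by apply: ae_leb_imply uu' => x E /E ->.
Qed.

(** The boundary values of the continuous representative are those of the
    primitive, because the two agree at points arbitrarily close to 0 and 1. *)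
Lemma boundary_values_primitive u g0 g1 c w : in_L2 w ->
  ae_eq (@leb R) unit_itv u (primitive c w) -> boundary_values u g0 g1 ->
  primitive c w 0 = g0 /\ primitive c w 1 = g1.
Proof.
move=> Lw uF [uc [cuc uuc <- <-]].
have aeE : {ae @leb R, forall x, unit_itv x -> uc x = primitive c w x}.
  apply: ae_leb_imply (ae_leb_and _ _ uF uuc) => x [E1 E2] xI.
  by rewrite -E1// -E2.
have cuc' x e : 0 <= x <= 1 -> 0 < e -> exists r : R, 0 < r /\
    forall y, 0 <= y <= 1 -> `|x - y| < r -> `|uc x - uc y| <= e.
  move=> xI e0; have xI' : `[0, 1]%classic x by rewrite /= in_itv.
  have /subspace_continuousP := cuc; move=> /(_ x xI')/cvgrPdist_le/(_ e e0).
  move=> /nbhs_ballP[r /= r0 H]; exists r; split=> // y yI xyr.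
  by apply: H => //=; rewrite in_itv.
have E x : 0 <= x <= 1 -> (forall r, 0 < r ->
    exists a b, [/\ 0 <= a, a < b, b <= 1 & forall y, a < y < b -> `|x - y| < r]) ->
    primitive c w x = uc x.
  move=> xI near_x; apply/eqP; rewrite -subr_eq0 -normr_le0.
  apply/ler_addgt0Pr => e e0; rewrite add0r.
  have e2 : 0 < e / 2 by rewrite divr_gt0.
  have [r [r0 Hr]] := cuc' x _ xI e2.
  have [r' [r'0 Hr']] := primitive_near c w Lw _ e2.
  have [|a [b [a0 ab b1 Hab]]] := near_x (Num.min r r').
    by rewrite lt_min r0.
  have [y [yab Ey]] := ae_ex _ a b a0 ab b1 aeE.
  have := Hab y yab; rewrite lt_min => /andP[xyr /ltW xyr'].
  have yI : 0 <= y <= 1 by case/andP: yab => ? ?; apply/andP; split; lra.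
  have := Hr y yI xyr; have := Hr' x y xI yI xyr'; rewrite -Ey !ler_norml.
  by move=> /andP[? ?] /andP[? ?]; apply/andP; split; lra.
split; apply: E; rewrite ?lexx ?ler01// => r r0.
  exists 0, (Num.min r 1); rewrite lexx lt_min r0 ltr01 ge_min lexx orbT; split=> //.
  by move=> y; rewrite lt_min ltr_norml => /and3P[? ? ?]; apply/andP; split; lra.
exists (Num.max 0 (1 - r)), 1; rewrite le_max lexx gt_max ltr01/= ltrBlDr ltrDl r0.
split=> // y; rewrite gt_max ltr_norml => /andP[/andP[? ?] ?]; apply/andP; split; lra.
Qed.

End Primitive.

(** * Integration by parts, interpolation and projection in V_h *)

Section FiniteElements.
Context {R : realType}.
Variables (n : nat) (n_gt0 : (0 < n)%N).
Implicit Types (u v w q F : R -> R) (a b c d s x y t : R) (i j m : nat).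

Local Notation x_ := (@node R n).

Lemma Vh_by_parts u u' g0 g1 v : H1_with_derivative u u' ->
  boundary_values u g0 g1 -> Vh n v ->
  ip u (derive1 v) = g1 * v 1 - g0 * v 0 - ip u' v.
Proof.
move=> [Lu Lu' wd] bv Vv.
have [c uF] := weak_derivative_primitive u u' Lu Lu' wd.
have [F0 F1] := boundary_values_primitive u g0 g1 c u' Lu' uF bv.
have LF := primitive_in_L2 c u' Lu'.
have Lv := Vh_in_L2 n n_gt0 v Vv; have Lv' := derive1_Vh_in_L2 n n_gt0 v Vv.
rewrite (ae_eq_ip u _ _ Lu LF Lv' uF).
set F := primitive c u' in F0 F1 LF *.
suff : ip F (derive1 v) + ip u' v = F 1 * v 1 - F 0 * v 0 by rewrite F0 F1 => E; lra.
rewrite !(ip_elements n n_gt0)// -big_split/=.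
transitivity (\sum_(0 <= i < n) (F (x_ i.+1) * v (x_ i.+1) - F (x_ i) * v (x_ i))).
  rewrite big_mkord; apply: eq_bigr => i _.
  have [c' [d [vcd vd]]] := Vh_element n v i Vv (ltn_ord i).
  have xi0 := @node_ge0 R n n_gt0 i; have xi1 := @node_le1 R n n_gt0 _ (ltn_ord i).
  have /ltW xii := @node_ltS R n n_gt0 i.
  rewrite -itgD//; [|exact: in_L2_integrable01M..].
  rewrite (vcd (x_ i)) ?lexx// (vcd (x_ i.+1)) ?xii ?lexx//.
  rewrite -(primitive_by_parts c u' Lu' c' d _ _ xi0 xii xi1).
  apply: eq_itg => t tI; rewrite vd// vcd//.
  by case/andP: tI => /ltW-> /ltW->.
by rewrite (telescope_sumr (fun i => F (x_ i) * v (x_ i)))// node0 (noden n n_gt0).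
Qed.

(** By exact integration, the difference of the two sides is 12 (b - a) times the
    squared value at the midpoint. *)
Lemma affine_inverse_inequality c d a b : 0 <= a -> a <= b -> b <= 1 ->
  d ^+ 2 * (b - a) ^+ 3 <= 12 * itg (fun t => (c + d * t) ^+ 2) a b.
Proof.
move=> a0 ab b1.
pose P t : R := c ^+ 2 * t + c * d * t ^+ 2 + d ^+ 2 / 3 * t ^+ 3.
have dP t : is_derive t 1 P ((c + d * t) ^+ 2).
  rewrite /P; apply: is_derive_eq; rewrite /GRing.scale/=; by field.
have cp : continuous (fun t => (c + d * t) ^+ 2).
  move=> t; apply: (@continuous_comp _ _ _ (fun t => c + d * t) (fun t => t ^+ 2)).
    by apply: cvgD; [exact: cvg_cst|apply: cvgM; [exact: cvg_cst|exact: cvg_id]].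
  exact: exprn_continuous.
rewrite (itg_derive _ _ _ _ ab dP cp) /P.
have H : 0 <= 12 * (b - a) * (c + d * ((a + b) / 2)) ^+ 2.
  by rewrite mulr_ge0 ?sqr_ge0// mulr_ge0// subr_ge0.
rewrite -subr_ge0; apply: le_trans H _; rewrite le_eqVlt; apply/orP; left.
by apply/eqP; field.
Qed.

Lemma Vh_inverse_inequality v : Vh n v ->
  ip (derive1 v) (derive1 v) <= 12 * n%:R ^+ 2 * ip v v.
Proof.
move=> Vv; have Lv := Vh_in_L2 n n_gt0 v Vv; have Lv' := derive1_Vh_in_L2 n n_gt0 v Vv.
rewrite !(ip_elements n n_gt0)// mulr_sumr; apply: ler_sum => i _.
have [c [d [vcd vd]]] := Vh_element n v i Vv (ltn_ord i).
have xi0 := @node_ge0 R n n_gt0 i; have xi1 := @node_le1 R n n_gt0 _ (ltn_ord i).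
have /ltW xii := @node_ltS R n n_gt0 i.
have n0 : 0 < n%:R :> R by rewrite ltr0n.
rewrite (eq_itg _ (fun=> d * d)); last by move=> t tI; rewrite vd.
rewrite (eq_itg (fun t => v t * v t) (fun t => (c + d * t) ^+ 2)); last first.
  by move=> t /andP[/ltW ta /ltW tb]; rewrite vcd ?ta.
have := affine_inverse_inequality c d _ _ xi0 xii xi1.
have hE : x_ i.+1 - x_ i = n%:R^-1 by rewrite node_step; ring.
rewrite itg_cst// hE.
move=> /(ler_wpM2l (ltW (exprn_gt0 2 n0))).
rewrite (_ : n%:R ^+ 2 * (d ^+ 2 * n%:R^-1 ^+ 3) = d * d / n%:R).
  by move=> /le_trans; apply; rewrite le_eqVlt; apply/orP; left; apply/eqP; ring.
by field; rewrite gt_eqF.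
Qed.

(** Nodal interpolation, as a combination of hat functions to get continuity at
    the nodes for free. *)
Definition interpolant F x : R := \sum_(0 <= j < n.+1) F (x_ j) * hat (n%:R * x - j%:R).

Lemma interpolantE F i x : (i < n)%N -> x_ i <= x <= x_ i.+1 ->
  interpolant F x = F (x_ i) + (F (x_ i.+1) - F (x_ i)) * (n%:R * x - i%:R).
Proof.
move=> lin /andP[xi xi1]; have n0 : 0 < n%:R :> R by rewrite ltr0n.
have s0 : 0 <= n%:R * x - i%:R.
  by move: xi; rewrite /node ler_pdivrMr// mulrC subr_ge0.
have s1 : n%:R * x - i%:R <= 1.
  by move: xi1; rewrite /node ler_pdivlMr// mulrC -natr1; lra.
(* only the hats centred at the two ends of the element contribute *)
rewrite /interpolant (@big_cat_nat _ _ _ i)//=; last by rewrite ltnW// ltnW.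
rewrite big_nat_cond big1 ?add0r; last first.
  move=> j; rewrite andbT => /andP[_ ji]; rewrite hat_out ?mulr0// ger0_norm.
    have : j.+1%:R <= i%:R :> R by rewrite ler_nat.
    by rewrite -natr1; lra.
  have : j%:R <= i%:R :> R by rewrite ler_nat ltnW.
  lra.
rewrite (@big_cat_nat _ _ _ i.+2)//=; last by rewrite ltnW.
rewrite [X in _ + X]big_nat_cond [X in _ + X]big1 ?addr0; last first.
  move=> j; rewrite andbT => /andP[ij _]; have : i.+2%:R <= j%:R :> R by rewrite ler_nat.
  by rewrite -2!natr1 => ?; rewrite hat_out ?mulr0// ler0_norm; lra.
rewrite big_nat_recr//= big_nat1 -natr1.
set s := n%:R * x - i%:R in s0 s1 *.
rewrite (_ : n%:R * x - (i%:R + 1) = s - 1); last by rewrite /s; ring.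
have N1 : `|s - 1| = 1 - s by rewrite ler0_norm; lra.
have -> : hat s = 1 - s.
  have N2 : `|s + 1| = s + 1 by rewrite ger0_norm; lra.
  by rewrite /hat /pospart (ger0_norm s0) N1 N2; field.
have -> : hat (s - 1) = s.
  have N2 : `|s - 1 - 1| = 2 - s by rewrite ler0_norm; lra.
  by rewrite /hat /pospart subrK (ger0_norm s0) N1 N2; field.
by ring.
Qed.

Lemma interpolant_continuous F : continuous (interpolant F).
Proof.
rewrite /interpolant; elim: n.+1 => [|m IH] x.
  by under eq_fun do rewrite big_geq//; exact: cvg_cst.
under eq_fun do rewrite big_nat_recr//=.
apply: cvgD; first exact: IH.
apply: cvgM; first exact: cvg_cst.
apply: (@continuous_comp _ _ _ (fun x => n%:R * x - m%:R) hat).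
  by apply: cvgB; [apply: cvgM; [exact: cvg_cst|exact: cvg_id]|exact: cvg_cst].
exact: hat_continuous.
Qed.

Lemma interpolant_Vh F : Vh n (interpolant F).
Proof.
split.
  by apply: continuous_subspaceT; exact: interpolant_continuous.
move=> i lin; exists (F (x_ i) - (F (x_ i.+1) - F (x_ i)) * i%:R),
  ((F (x_ i.+1) - F (x_ i)) * n%:R) => x; rewrite in_itv/= => xI.
by rewrite (interpolantE _ i)//; ring.
Qed.

Section Interpolation.
Variables (c : R) (w : R -> R) (Lw : in_L2 w).
Let F := primitive c w.
Let V := interpolant F.

Let n0 : 0 < n%:R :> R. Proof. by rewrite ltr0n. Qed.

Let w2E : ip w w = \sum_(i < n) itg (fun t => w t ^+ 2) (x_ i) (x_ i.+1).
Proof.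
by rewrite (ip_elements n n_gt0)//; apply: eq_bigr => i _; apply: eq_itg => t _; rewrite expr2.
Qed.

(** On an element the interpolant is a convex combination of the two nodal
    values, each of which is within sqrt (J / n) of F, where J is the integral of
    w^2 over the element. *)
Lemma interpolant_error :
  ip (fun x => F x - V x) (fun x => F x - V x) <= n%:R^-1 ^+ 2 * ip w w.
Proof.
have LF : in_L2 F := primitive_in_L2 c w Lw.
have LV : in_L2 V by apply: (Vh_in_L2 n n_gt0); exact: interpolant_Vh.
have LFV := in_L2B _ _ LF LV.
rewrite w2E (ip_elements n n_gt0)// mulr_sumr; apply: ler_sum => i _.
have xi0 := @node_ge0 R n n_gt0 i; have xi1 := @node_le1 R n n_gt0 _ (ltn_ord i).
have /ltW xii := @node_ltS R n n_gt0 i.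
have w2i := in_L2_sqr _ Lw.
set J := itg (fun t => w t ^+ 2) (x_ i) (x_ i.+1).
have hV0 : 0 <= n%:R^-1 :> R by rewrite invr_ge0 ltW.
have stepE := @node_step R n i.
have -> : n%:R^-1 ^+ 2 * J = itg (fun=> n%:R^-1 * J) (x_ i) (x_ i.+1).
  by rewrite itg_cst// stepE; ring.
apply: le_itg => //; [exact: in_L2_integrable01M|exact: integrable01_cst|].
move=> t /andP[/ltW it /ltW ti].
have Jsplit : J = itg (fun t => w t ^+ 2) (x_ i) t + itg (fun t => w t ^+ 2) t (x_ i.+1).
  by apply: itg_split.
have p a b : 0 <= itg (fun t => w t ^+ 2) a b.
  by apply: itg_ge0 => z _; exact: sqr_ge0.
have t1 : t <= 1 by lra.
have t0 : 0 <= t by lra.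
have A : (F t - F (x_ i)) ^+ 2 <= n%:R^-1 * J.
  apply: le_trans (primitive_sqrB c w Lw _ _ xi0 it t1) _.
  apply: ler_pM => //; [lra|lra|rewrite Jsplit lerDl; exact: p].
have B : (F t - F (x_ i.+1)) ^+ 2 <= n%:R^-1 * J.
  rewrite -sqrrN opprB; apply: le_trans (primitive_sqrB c w Lw _ _ t0 ti xi1) _.
  apply: ler_pM => //; [lra|lra|rewrite Jsplit lerDr; exact: p].
rewrite /V (interpolantE _ i)// ?it//.
have s0 : 0 <= n%:R * t - i%:R.
  by move: it; rewrite /node ler_pdivrMr// mulrC subr_ge0.
have s1 : n%:R * t - i%:R <= 1.
  by move: ti; rewrite /node ler_pdivlMr// mulrC -natr1; lra.
move: s0 s1 A B; set s := n%:R * t - i%:R; set K := n%:R^-1 * J.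
set f := F t; set f0 := F _; set f1 := F _ => s0 s1 A B.
have C : 0 <= s * (1 - s) * (f1 - f0) ^+ 2.
  by rewrite mulr_ge0 ?sqr_ge0// mulr_ge0// subr_ge0.
have := ler_wpM2l s0 B.
have : (1 - s) * (f - f0) ^+ 2 <= (1 - s) * K by rewrite ler_wpM2l// subr_ge0.
nra.
Qed.

(** On an element the slope is the mean value of w. *)
Lemma interpolant_stable : ip (derive1 V) (derive1 V) <= ip w w.
Proof.
have VV := interpolant_Vh F; have LV' := derive1_Vh_in_L2 n n_gt0 V VV.
rewrite w2E (ip_elements n n_gt0)//; apply: ler_sum => i _.
have xi0 := @node_ge0 R n n_gt0 i; have xi1 := @node_le1 R n n_gt0 _ (ltn_ord i).
have /ltW xii := @node_ltS R n n_gt0 i.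
pose d := (F (x_ i.+1) - F (x_ i)) * n%:R.
have Vd x : x_ i < x < x_ i.+1 -> derive1 V x = d.
  apply: (@affine_derive1 R V _ _ (F (x_ i) - (F (x_ i.+1) - F (x_ i)) * i%:R)) => y.
  by move=> /andP[/ltW iy /ltW yi]; rewrite /V (interpolantE _ i) ?iy// /d; ring.
rewrite (eq_itg _ (fun=> d * d)); last by move=> t tI; rewrite Vd.
have hE : x_ i.+1 - x_ i = n%:R^-1 by rewrite node_step; ring.
have := primitive_sqrB c w Lw _ _ xi0 xii xi1.
rewrite hE ler_pdivlMl//.
apply: le_trans; rewrite itg_cst// hE.
rewrite le_eqVlt; apply/orP; left; apply/eqP; rewrite /d -/F.
by field; rewrite gt_eqF.
Qed.

End Interpolation.

(** The projection differs from the interpolant by a projected interpolation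
    error of order h; the inverse inequality turns it into a bounded gradient. *)
Lemma L2_projection_H1_stable u u' w : H1_with_derivative u u' ->
  L2_projection (Vh n) u w ->
  ip (derive1 w) (derive1 w) <= 26 * ip u' u'.
Proof.
have arith1 (A B C : R) : A = B -> 2 * B <= 1 * C + 1^-1 * A -> A <= C.
  by rewrite invr1 => ->; lra.
have arith2 (A B C : R) : A - B - (B - C) = A - 2 * B + C by ring.
have arith3 (A B C D Z : R) : D = A - 2 * B + C -> D <= 12 * Z -> C <= Z ->
  2 * B <= 2^-1 * A + 2^-1^-1 * C -> A <= 26 * Z by rewrite invrK; lra.
move=> [Lu Lu' wd] [Vw orth].
have [c uF] := weak_derivative_primitive u u' Lu Lu' wd.
have LF := primitive_in_L2 c u' Lu'.
set F := primitive c u' in uF LF; pose V := interpolant F.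
have VV : Vh n V by exact: interpolant_Vh.
have Lw := Vh_in_L2 n n_gt0 w Vw; have LV := Vh_in_L2 n n_gt0 V VV.
have Lw' := derive1_Vh_in_L2 n n_gt0 w Vw; have LV' := derive1_Vh_in_L2 n n_gt0 V VV.
have Ve := Vh_sub n w V Vw VV; set e := w \- V in Ve.
have Le : in_L2 e := Vh_in_L2 n n_gt0 e Ve.
have Le' := derive1_Vh_in_L2 n n_gt0 e Ve.
have err := interpolant_error c u' Lu'; rewrite -/F -/V in err.
have stab := interpolant_stable c u' Lu'; rewrite -/F -/V in stab.
have inv := Vh_inverse_inequality e Ve.
have n0 : 0 < n%:R :> R by rewrite ltr0n.
have LuV := in_L2B _ _ Lu LV; have LFV := in_L2B _ _ LF LV.
have errE : ip (fun x => u x - V x) (fun x => u x - V x) =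
    ip (fun x => F x - V x) (fun x => F x - V x).
  have aeV : ae_eq (@leb R) unit_itv (fun x => u x - V x) (fun x => F x - V x).
    by apply: ae_leb_imply uF => x E /E ->.
  rewrite (ae_eq_ip _ _ _ LuV LFV LuV aeV) ipC.
  by rewrite (ae_eq_ip _ _ _ LuV LFV LFV aeV).
have ee : ip e e <= ip (fun x => u x - V x) (fun x => u x - V x).
  have E : ip e e = ip (fun x => u x - V x) e.
    have := orth e Ve; rewrite (ipBl u w e Lu Lw Le) => /eqP.
    rewrite subr_eq0 => /eqP uw.
    by rewrite (ipBl u V e Lu LV Le) uw -(ipBl w V e Lw LV Le).
  exact: arith1 E (ip_young 1 _ _ ltr01 LuV Le).
have e'e' : ip (derive1 e) (derive1 e) <= 12 * ip u' u'.
  apply: le_trans inv _.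
  have := le_trans ee _; rewrite errE => /(_ _ err).
  have n2 : 0 <= 12 * n%:R ^+ 2 :> R by rewrite mulr_ge0// sqr_ge0.
  move=> /(ler_wpM2l n2) /le_trans; apply.
  by rewrite le_eqVlt; apply/orP; left; apply/eqP; field; rewrite gt_eqF.
have E : ip (derive1 e) (derive1 e)
    = ip (derive1 w) (derive1 w) - 2 * ip (derive1 w) (derive1 V)
      + ip (derive1 V) (derive1 V).
  rewrite (ip_derive1_sub n n_gt0 _ w V Le' Vw VV).
  rewrite (ipC (derive1 w) (derive1 e)) (ipC (derive1 V) (derive1 e)).
  rewrite (ip_derive1_sub n n_gt0 _ w V Lw' Vw VV).
  rewrite (ip_derive1_sub n n_gt0 _ w V LV' Vw VV).
  by rewrite (ipC (derive1 V) (derive1 w)); exact: arith2.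
have half0 : 0 < 2^-1 :> R by rewrite invr_gt0.
exact: arith3 E e'e' stab (ip_young _ _ _ half0 Lw' LV').
Qed.

End FiniteElements.

(** * Energy estimates for the scheme *)

Section Scheme.
Context {R : realType}.
Variables (a : R -> R) (alow aup : R).
Hypotheses (a_meas : measurable_fun (@unit_itv R) a) (alow_gt0 : 0 < alow).
Hypothesis a_bounds : forall x : R, unit_itv x -> alow <= a x <= aup.
Implicit Types (u v w q : R -> R).

Let a01 x : 0 < x < 1 -> alow <= a x <= aup.
Proof. by move=> x01; apply: a_bounds; rewrite /unit_itv/= in_itv. Qed.

Lemma coef_norm x : 0 < x < 1 -> `|a x| <= aup.
Proof. by move=> /a01/andP[l h]; rewrite ger0_norm//; exact: le_trans (ltW alow_gt0) l. Qed.

Lemma coef_in_L2 u : in_L2 u -> in_L2 (fun x => a x * u x).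
Proof. exact: in_L2Ml a_meas coef_norm. Qed.

Lemma coef_coercive u : in_L2 u -> alow * ip u u <= ip (fun x => a x * u x) u.
Proof.
move=> Lu; have Lau := coef_in_L2 _ Lu.
rewrite -(ipZl alow u u Lu Lu) !ipE; apply: le_itg => //.
- exact: in_L2_integrable01M (in_L2Z _ _ Lu) Lu.
- exact: in_L2_integrable01M.
move=> x /a01/andP[l _]; rewrite -!mulrA ler_wpM2r// -expr2 sqr_ge0//.
Qed.

Lemma coef_bounded u : in_L2 u ->
  ip (fun x => a x * u x) (fun x => a x * u x) <= aup ^+ 2 * ip u u.
Proof.
move=> Lu; have Lau := coef_in_L2 _ Lu.
have Lc := in_L2Z aup _ Lu.
have -> : aup ^+ 2 * ip u u = ip (fun x => aup * u x) (fun x => aup * u x).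
  by rewrite (ipZl aup u _ Lu Lc) (ipZr aup u u Lu Lu) mulrA -expr2.
rewrite !ipE; apply: le_itg => //; [exact: in_L2_integrable01M..|].
move=> x /a01/andP[l h].
have a0 : 0 <= a x := le_trans (ltW alow_gt0) l.
by rewrite -!expr2 !exprMn ler_wpM2r ?sqr_ge0// ler_sqr ?nnegrE// (le_trans a0).
Qed.

(** Pythagoras. *)
Lemma projection_error_le (W : set (R -> R)) u w : in_L2 u -> in_L2 w ->
  L2_projection W u w -> ip (u \- w) (u \- w) <= ip u u.
Proof.
move=> Lu Lw [Ww orth]; have Le := in_L2B _ _ Lu Lw.
have := orth w Ww; rewrite (ipBl u w w Lu Lw Lw) => /eqP; rewrite subr_eq0 => /eqP E.
rewrite (ipBl u w _ Lu Lw Le) (ipBr u w u Lu Lw Lu) (ipBr u w w Lu Lw Lw) (ipC w u) E.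
by rewrite subrr subr0 lerBlDr lerDl ip_ge0.
Qed.

Section Solution.
Variables (g0 g1 : R) (p0 m0 : R -> R) (n : nat) (tau eps : R).
Hypotheses (n_gt0 : (0 < n)%N) (tau_gt0 : 0 < tau).
Variables (p m : nat -> R -> R).
Hypothesis sol : discrete_solution a g0 g1 p0 m0 n tau eps p m.

Lemma solution_Qh k : Qh n (p k).
Proof. by case: sol => -[Q0 _] _ H; case: k => [//|k]; have [] := H k.+1. Qed.

Lemma solution_Vh k : (0 < eps) || (0 < k)%N -> Vh n (m k).
Proof.
case: sol => _ V0 H; case: k => [|k _]; last by have [] := H k.+1.
by rewrite orbF => /V0[].
Qed.

Lemma mass_equation k q : (0 < k)%N -> Qh n q ->
  ip (dtau tau p k) q + ip (derive1 (m k)) q = 0.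
Proof. by move=> k0; case: sol => _ _ /(_ k k0)[_ _ H _]; exact: H. Qed.

Lemma momentum_equation k v : (0 < k)%N -> Vh n v ->
  eps ^+ 2 * ip (dtau tau m k) v - ip (p k) (derive1 v)
    + ip (fun x => a x * m k x) v = g0 * v 0 - g1 * v 1.
Proof. by move=> k0; case: sol => _ _ /(_ k k0)[_ _ _ H]; exact: H. Qed.

End Solution.

Section TimeDerivative.
Variables (g0 g1 : R) (p0 dp0 m0 dm0 : R -> R) (n : nat) (tau eps : R).
Hypotheses (Hp : H1_with_derivative p0 dp0) (Hm : H1_with_derivative m0 dm0).
Hypothesis bp : boundary_values p0 g0 g1.
Hypotheses (n_gt0 : (0 < n)%N) (tau_gt0 : 0 < tau) (eps_gt0 : 0 < eps).
Variables (p m : nat -> R -> R).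
Hypothesis sol : discrete_solution a g0 g1 p0 m0 n tau eps p m.

Let Vm k : Vh n (m k).
Proof. by apply: (solution_Vh _ _ _ _ _ _ _ _ _ sol); rewrite eps_gt0. Qed.
Let Qp k : Qh n (p k). Proof. exact: (solution_Qh _ _ _ _ _ _ _ _ _ sol). Qed.
Let Lm k : in_L2 (m k) := Vh_in_L2 n n_gt0 _ (Vm k).
Let Lp k : in_L2 (p k) := Qh_in_L2 n n_gt0 _ (Qp k).
Let r := dtau tau p.
Let d := dtau tau m.
Let Qr k : Qh n (r k). Proof. exact: (Qh_diffq n tau). Qed.
Let Vd k : Vh n (d k). Proof. exact: (Vh_diffq n tau). Qed.
Let Lr k : in_L2 (r k) := Qh_in_L2 n n_gt0 _ (Qr k).
Let Ld k : in_L2 (d k) := Vh_in_L2 n n_gt0 _ (Vd k).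
Let Ld' k : in_L2 (derive1 (d k)) := derive1_Vh_in_L2 n n_gt0 _ (Vd k).

Let energy k : R := ip (r k) (r k) + eps ^+ 2 * ip (d k) (d k).

Let increment_p k : ip (r k.+1) (derive1 (d k.+1)) =
  (ip (p k.+1) (derive1 (d k.+1)) - ip (p k) (derive1 (d k.+1))) / tau.
Proof. exact: ip_diffq. Qed.

Let increment_m k : ip (derive1 (d k.+1)) (r k.+1) =
  (ip (derive1 (m k.+1)) (r k.+1) - ip (derive1 (m k)) (r k.+1)) / tau.
Proof. exact: (ip_derive1_diffq n n_gt0). Qed.

Let increment_am k : ip (fun x => a x * d k.+1 x) (d k.+1) =
  (ip (fun x => a x * m k.+1 x) (d k.+1) - ip (fun x => a x * m k x) (d k.+1)) / tau.
Proof.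
rewrite -(ip_diffq tau (d k.+1) _ _ (Ld _) (coef_in_L2 _ (Lm _)) (coef_in_L2 _ (Lm _))).
by apply: eq_ip => x _; congr (_ * _); rewrite /d /dtau/= mulrA mulrBr.
Qed.

(** The quotients are tested with themselves in the differences of two
    consecutive steps. *)
Lemma energy_decay k : (0 < k)%N ->
  energy k.+1 + 2 * alow * (tau * ip (d k.+1) (d k.+1)) <= energy k.
Proof.
(* X is the coupling term, which cancels between the two tested equations. *)
have arith (e RR Rjk RRj DD Djk DDj X mk mj pk pj amk amj A g : R) :
  0 <= e -> RR + mk = 0 -> Rjk + mj = 0 ->
  e * DD - pk + amk = g -> e * Djk - pj + amj = g ->
  X = (pk - pj) / tau -> X = (mk - mj) / tau -> A = (amk - amj) / tau ->
  2 * Rjk <= 1 * RRj + 1^-1 * RR -> 2 * Djk <= 1 * DDj + 1^-1 * DD ->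
  alow * DD <= A -> RR + e * DD + 2 * alow * (tau * DD) <= RRj + e * DDj.
  move=> e0 E1 E2 E3 E4 X1 X2 A1; rewrite invr1 !mul1r => Y1 Y2 H.
  have tX1 : tau * X = pk - pj by rewrite X1; field; rewrite gt_eqF.
  have tX2 : tau * X = mk - mj by rewrite X2; field; rewrite gt_eqF.
  have tA : tau * A = amk - amj by rewrite A1; field; rewrite gt_eqF.
  have := ler_wpM2l (ltW tau_gt0) H; have := ler_wpM2l e0 Y2.
  lra.
move=> k0.
apply: (arith (eps ^+ 2) _ _ _ _ _ _ _ _ _ _ _ _ _ _ _ (sqr_ge0 eps)
  (mass_equation _ _ _ _ _ _ _ _ _ sol k.+1 _ isT (Qr k.+1))
  (mass_equation _ _ _ _ _ _ _ _ _ sol k _ k0 (Qr k.+1))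
  (momentum_equation _ _ _ _ _ _ _ _ _ sol k.+1 _ isT (Vd k.+1))
  (momentum_equation _ _ _ _ _ _ _ _ _ sol k _ k0 (Vd k.+1))
  (increment_p k) _ (increment_am k)
  (ip_young 1 _ _ ltr01 (Lr k) (Lr k.+1))
  (ip_young 1 _ _ ltr01 (Ld k) (Ld k.+1))
  (coef_coercive _ (Ld k.+1))).
by rewrite ipC; exact: increment_m.
Qed.

(** 26 is the constant of the H^1-stability of the projection; 2 / eps^2 is the
    Young weight for which both terms paired with d^1 are absorbed by
    eps^2 |d^1|^2. *)
Definition initial_bound : R :=
  26 * ip dm0 dm0 + 2 / eps ^+ 2 *
    (ip (fun x => dp0 x + a x * m0 x) (fun x => dp0 x + a x * m0 x)
     + aup ^+ 2 * ip m0 m0).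

(** At the first step the boundary terms cancel against those of the exact
    integration by parts of p0, which applies because the derivative of d^1 is
    in Q_h and so does not see the projection of p0. What remains is the residual
    of the initial data, up to the projection error of m0. *)
Lemma energy_first : energy 1 + 2 * alow * (tau * ip (d 1) (d 1)) <= initial_bound.
Proof.
have arith (RR DD X m1 mh p1 ph pp am1 amh am A dp g G b B MM N Z : R) :
  RR + m1 = 0 -> eps ^+ 2 * DD - p1 + am1 = g ->
  X = (p1 - ph) / tau -> X = (m1 - mh) / tau -> A = (am1 - amh) / tau ->
  pp - ph = 0 -> pp = - g - dp ->
  amh = am - b ->
  - (2 * mh) <= 1 * N + 1^-1 * RR ->
  - (2 * (dp + am)) <= (2 / eps ^+ 2) * G + (2 / eps ^+ 2)^-1 * DD ->
  2 * b <= (2 / eps ^+ 2) * B + (2 / eps ^+ 2)^-1 * DD ->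
  alow * DD <= A -> N <= 26 * Z -> B <= aup ^+ 2 * MM ->
  RR + eps ^+ 2 * DD + 2 * alow * (tau * DD)
    <= 26 * Z + 2 / eps ^+ 2 * (G + aup ^+ 2 * MM).
  move=> E1 E2 X1 X2 A1 Epp Epp' Eam; rewrite invr1 !mul1r => Y1 Y2 Y3 H HN HB.
  have e2 : 0 < eps ^+ 2 by rewrite exprn_gt0.
  have ie2 : 0 <= 2 / eps ^+ 2 by rewrite divr_ge0// ltW.
  have tX1 : tau * X = p1 - ph by rewrite X1; field; rewrite gt_eqF.
  have tX2 : tau * X = m1 - mh by rewrite X2; field; rewrite gt_eqF.
  have tA : tau * A = am1 - amh by rewrite A1; field; rewrite gt_eqF.
  have HtA := ler_wpM2l (ltW tau_gt0) H.
  have HB' := ler_wpM2l ie2 HB.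
  have E : (2 / eps ^+ 2)^-1 = eps ^+ 2 / 2 by field; rewrite gt_eqF.
  rewrite E in Y2 Y3; move: Y2 Y3 HB'; rewrite mulrDr.
  by set c := 2 / eps ^+ 2 => Y2 Y3 HB'; lra.
have [[Lp0 Ldp0 _] [Lm0 Ldm0 _]] := (Hp, Hm).
have Lap := in_L2D _ _ Ldp0 (coef_in_L2 _ Lm0).
case: (sol) => Ppi /(_ eps_gt0) Pmi _.
have Le := in_L2B _ _ Lm0 (Lm 0).
have s0 : 0 < 2 / eps ^+ 2 by rewrite divr_gt0// exprn_gt0.
have Lm0' := derive1_Vh_in_L2 n n_gt0 _ (Vm 0).
have Qd' := derive1_Vh n _ (Vd 1).
have Epp : ip p0 (derive1 (d 1)) - ip (p 0%N) (derive1 (d 1)) = 0.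
  by rewrite -(ipBl p0 (p 0%N) _ Lp0 (Lp 0) (Ld' 1)); case: Ppi => _; exact.
have Ebp : ip p0 (derive1 (d 1)) = - (g0 * d 1%N 0 - g1 * d 1%N 1) - ip dp0 (d 1).
  by rewrite (Vh_by_parts n n_gt0 p0 dp0 g0 g1 _ Hp bp (Vd 1)) opprB.
have Eam : ip (fun x => a x * m 0%N x) (d 1) = ip (fun x => a x * m0 x) (d 1)
    - ip (fun x => a x * (m0 x - m 0%N x)) (d 1).
  rewrite -(ipBl _ _ _ (coef_in_L2 _ Lm0) (coef_in_L2 _ Le) (Ld 1)).
  by apply: eq_ip => x _; congr (_ * _); ring.
have Y2 := ip_youngN _ _ _ s0 Lap (Ld 1).
rewrite {1}(ipDl dp0 (fun x => a x * m0 x) _ Ldp0 (coef_in_L2 _ Lm0) (Ld 1)) in Y2.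
have HB := le_trans (coef_bounded _ Le)
  (ler_wpM2l (sqr_ge0 aup) (projection_error_le _ _ _ Lm0 (Lm 0) Pmi)).
apply: (arith _ _ _ _ _ _ _ _ _ _ _ _ _ _ _ _ _ _ _ _
  (mass_equation _ _ _ _ _ _ _ _ _ sol 1 _ isT (Qr 1))
  (momentum_equation _ _ _ _ _ _ _ _ _ sol 1 _ isT (Vd 1))
  (increment_p 0) _ (increment_am 0) Epp Ebp Eam
  (ip_youngN 1 _ _ ltr01 Lm0' (Lr 1)) Y2
  (ip_young _ _ _ s0 (coef_in_L2 _ Le) (Ld 1))
  (coef_coercive _ (Ld 1))
  (L2_projection_H1_stable n n_gt0 _ _ _ Hm Pmi) HB).
by rewrite ipC; exact: increment_m.
Qed.

Lemma sum_dtau_m_le k :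
  2 * alow * \sum_(1 <= j < k.+1) tau * ip (d j) (d j) <= initial_bound.
Proof.
have e0 j : 0 <= energy j.
  by rewrite /energy addr_ge0 ?ip_ge0// mulr_ge0 ?sqr_ge0 ?ip_ge0.
suff H : energy k.+1 + 2 * alow * \sum_(1 <= j < k.+2) tau * ip (d j) (d j)
    <= initial_bound.
  apply: le_trans H; rewrite [X in _ <= _ + _ * X]big_nat_recr//= mulrDr.
  have D0 : 0 <= 2 * alow * (tau * ip (d k.+1) (d k.+1)).
    by rewrite !mulr_ge0 ?ip_ge0 ?ltW.
  by rewrite addrCA lerDl addr_ge0.
elim: k => [|k IH]; first by rewrite big_nat1; exact: energy_first.
apply: le_trans IH; rewrite big_nat_recr//= mulrDr addrCA [leRHS]addrC lerD2l.
exact: energy_decay.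
Qed.

End TimeDerivative.

Section Comparison.
Variables (g0 g1 : R) (p0 m0 : R -> R) (n : nat) (tau eps : R).
Hypotheses (n_gt0 : (0 < n)%N) (tau_gt0 : 0 < tau) (eps_gt0 : 0 < eps).
Variables (p m p' m' : nat -> R -> R).
Hypothesis sol : discrete_solution a g0 g1 p0 m0 n tau eps p m.
Hypothesis sol' : discrete_solution a g0 g1 p0 m0 n tau 0 p' m'.

Let Vm k : Vh n (m k).
Proof. by apply: (solution_Vh _ _ _ _ _ _ _ _ _ sol); rewrite eps_gt0. Qed.
Let Qp k : Qh n (p k). Proof. exact: (solution_Qh _ _ _ _ _ _ _ _ _ sol). Qed.
Let Vm' k : Vh n (m' k.+1).
Proof. by apply: (solution_Vh _ _ _ _ _ _ _ _ _ sol'); rewrite orbT. Qed.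
Let Qp' k : Qh n (p' k). Proof. exact: (solution_Qh _ _ _ _ _ _ _ _ _ sol'). Qed.
Let P k := p k \- p' k.
Let M k := m k \- m' k.
Let QP k : Qh n (P k). Proof. exact: Qh_sub. Qed.
Let VM k : Vh n (M k.+1). Proof. exact: Vh_sub. Qed.
Let Lp k : in_L2 (p k) := Qh_in_L2 n n_gt0 _ (Qp k).
Let Lp' k : in_L2 (p' k) := Qh_in_L2 n n_gt0 _ (Qp' k).
Let Lm k : in_L2 (m k) := Vh_in_L2 n n_gt0 _ (Vm k).
Let Lm' k : in_L2 (m' k.+1) := Vh_in_L2 n n_gt0 _ (Vm' k).
Let LP k : in_L2 (P k) := Qh_in_L2 n n_gt0 _ (QP k).
Let LM k : in_L2 (M k.+1) := Vh_in_L2 n n_gt0 _ (VM k).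
Let LM' k : in_L2 (derive1 (M k.+1)) := derive1_Vh_in_L2 n n_gt0 _ (VM k).

(** The difference solves the limit scheme with forcing - eps^2 times the
    difference quotient of m, half absorbed by the damping. *)
Lemma comparison_step k :
  ip (P k.+1) (P k.+1) + alow * (tau * ip (M k.+1) (M k.+1)) <=
  ip (P k) (P k) + eps ^+ 4 / alow *
    (tau * ip (dtau tau m k.+1) (dtau tau m k.+1)).
Proof.
have arith (PP PPk Pk A B C D rp rp' mp mp' pm pm' DM am am' x g MM DD : R) :
  rp = (A - B) / tau -> rp' = (C - D) / tau ->
  PP = A - C -> Pk = B - D ->
  rp + mp = 0 -> rp' + mp' = 0 ->
  eps ^+ 2 * DM - pm + am = g -> 0 ^+ 2 * x - pm' + am' = g ->
  mp - mp' = pm - pm' ->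
  2 * Pk <= 1 * PPk + 1^-1 * PP ->
  - (2 * DM) <= (eps ^+ 2 / alow) * DD + (eps ^+ 2 / alow)^-1 * MM ->
  alow * MM <= am - am' ->
  PP + alow * (tau * MM) <= PPk + eps ^+ 4 / alow * (tau * DD).
  move=> Erp Erp' EP EPk E1 E1' E2 E2' Ed; rewrite invr1 !mul1r => Y1 Y2 H.
  have e2 : 0 < eps ^+ 2 by rewrite exprn_gt0.
  have trp : tau * rp = A - B by rewrite Erp; field; rewrite gt_eqF.
  have trp' : tau * rp' = C - D by rewrite Erp'; field; rewrite gt_eqF.
  have tE1 : tau * rp + tau * mp = 0 by rewrite -mulrDr E1 mulr0.
  have tE1' : tau * rp' + tau * mp' = 0 by rewrite -mulrDr E1' mulr0.
  have te2 : 0 <= tau * eps ^+ 2 by rewrite mulr_ge0// ltW.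
  have := ler_wpM2l te2 Y2.
  have -> : tau * eps ^+ 2 * (eps ^+ 2 / alow * DD + (eps ^+ 2 / alow)^-1 * MM)
    = eps ^+ 4 / alow * (tau * DD) + alow * (tau * MM).
    by field; rewrite !gt_eqF.
  have := ler_wpM2l (ltW tau_gt0) H.
  have E2'' : - pm' + am' = g by rewrite -E2' expr0n/= mul0r add0r.
  have tD : tau * (eps ^+ 2 * DM) + tau * (am - am') = tau * mp - tau * mp'.
    rewrite -mulrDr -mulrBr Ed; congr (tau * _); lra.
  rewrite mulrN => H1 H2.
  have : tau * (eps ^+ 2 * DM) = tau * eps ^+ 2 * DM by rewrite mulrA.
  move: H1 H2; rewrite [tau * eps ^+ 2 * (2 * DM)]mulrCA => H1 H2 E3; lra.
have s0 : 0 < eps ^+ 2 / alow by rewrite divr_gt0// exprn_gt0.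
have LaM : ip (fun x => a x * M k.+1 x) (M k.+1) =
    ip (fun x => a x * m k.+1 x) (M k.+1) - ip (fun x => a x * m' k.+1 x) (M k.+1).
  rewrite -(ipBl _ _ _ (coef_in_L2 _ (Lm _)) (coef_in_L2 _ (Lm' _)) (LM k)).
  by apply: eq_ip => x _; congr (_ * _); exact: mulrBr.
have coer := coef_coercive _ (LM k); rewrite LaM in coer.
have Vdm := Vh_diffq n tau _ _ (Vm k.+1) (Vm k).
apply: (arith _ _ _ _ _ _ _ _ _ _ _ _ _ _ _ _ _ _ _ _
  (ip_diffq tau (P k.+1) _ _ (LP _) (Lp _) (Lp k))
  (ip_diffq tau (P k.+1) _ _ (LP _) (Lp' _) (Lp' k))
  (ipBl _ _ _ (Lp _) (Lp' _) (LP k.+1)) (ipBl _ _ _ (Lp k) (Lp' k) (LP k.+1))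
  (mass_equation _ _ _ _ _ _ _ _ _ sol k.+1 _ isT (QP k.+1))
  (mass_equation _ _ _ _ _ _ _ _ _ sol' k.+1 _ isT (QP k.+1))
  (momentum_equation _ _ _ _ _ _ _ _ _ sol k.+1 _ isT (VM k))
  (momentum_equation _ _ _ _ _ _ _ _ _ sol' k.+1 _ isT (VM k))
  _
  (ip_young 1 _ _ ltr01 (LP k) (LP k.+1))
  (ip_youngN _ _ _ s0 (Vh_in_L2 n n_gt0 _ Vdm) (LM k))
  coer).
rewrite -(ip_derive1_sub n n_gt0 _ _ _ (LP k.+1) (Vm k.+1) (Vm' k)).
by rewrite -(ipBl _ _ _ (Lp _) (Lp' _) (LM' k)) ipC.
Qed.

Lemma comparison_sum k : ip (P 0) (P 0) = 0 ->
  ip (P k) (P k) + alow * \sum_(1 <= j < k.+1) tau * ip (M j) (M j) <=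
  eps ^+ 4 / alow * \sum_(1 <= j < k.+1) tau * ip (dtau tau m j) (dtau tau m j).
Proof.
have arith (A B C D E F G : R) : A + B <= C + D -> C + F <= G -> A + (F + B) <= G + D.
  by move=> *; lra.
move=> P00; elim: k => [|k IH]; first by rewrite !big_geq// !mulr0 addr0 P00.
rewrite big_nat_recr//= [X in _ <= _ * X]big_nat_recr//= !mulrDr.
exact: arith (comparison_step k) IH.
Qed.

End Comparison.
End Scheme.

Theorem theorem3 (R : realType) (a : R -> R) (alow aup : R)
  (a_meas : measurable_fun (@unit_itv R) a)
  (alow_gt0 : 0 < alow)
  (a_bounds : forall x : R, unit_itv x -> alow <= a x <= aup) :
  exists C : R, 0 < C /\
    forall (g0 g1 : R) (p0 dp0 m0 dm0 : R -> R),
    H1_with_derivative p0 dp0 ->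
    H1_with_derivative m0 dm0 ->
    boundary_values p0 g0 g1 ->
    forall (n : nat) (tau eps : R),
    (0 < n)%N -> 0 < tau -> 0 < eps ->
    forall peps meps pzero mzero : nat -> R -> R,
    discrete_solution a g0 g1 p0 m0 n tau eps peps meps ->
    discrete_solution a g0 g1 p0 m0 n tau 0 pzero mzero ->
    ae_eq leb unit_itv (peps 0%N) (pzero 0%N) ->
    forall k : nat,
      L2norm (peps k \- pzero k) ^+ 2
        + 2 * alow * \sum_(1 <= j < k.+1)
            tau * L2norm (meps j \- mzero j) ^+ 2
      <= C * eps ^+ 4 *
         (L2norm dm0 ^+ 2
          + 1 / eps ^+ 2 * L2norm (fun x => dp0 x + a x * m0 x) ^+ 2
          + aup ^+ 2 / eps ^+ 2 * L2norm m0 ^+ 2).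
Proof.
exists (26 / alow ^+ 2); split; first by rewrite divr_gt0// exprn_gt0.
move=> g0 g1 p0 dp0 m0 dm0 Hp Hm bp n tau eps n_gt0 tau_gt0 eps_gt0.
move=> peps meps pzero mzero sol sol' init k.
have arith (PP SM SD Z G MM : R) : 0 <= PP -> 0 <= Z -> 0 <= G -> 0 <= MM ->
  PP + alow * SM <= eps ^+ 4 / alow * SD ->
  2 * alow * SD <= 26 * Z + 2 / eps ^+ 2 * (G + aup ^+ 2 * MM) ->
  PP + 2 * alow * SM <= 26 / alow ^+ 2 * eps ^+ 4 *
    (Z + 1 / eps ^+ 2 * G + aup ^+ 2 / eps ^+ 2 * MM).
  move=> PP0 Z0 G0 MM0 H1 H2.
  have e4 : 0 <= eps ^+ 4 / alow ^+ 2 by rewrite divr_ge0 ?exprn_ge0// ltW.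
  have X0 : 0 <= 24 / eps ^+ 2 * (G + aup ^+ 2 * MM).
    apply: mulr_ge0; first by rewrite divr_ge0 ?sqr_ge0.
    by rewrite addr_ge0// mulr_ge0 ?sqr_ge0.
  have : 2 * alow * SD <=
      26 * (Z + 1 / eps ^+ 2 * G + aup ^+ 2 / eps ^+ 2 * MM).
    rewrite (_ : 26 * _ = 26 * Z + 2 / eps ^+ 2 * (G + aup ^+ 2 * MM)
      + 24 / eps ^+ 2 * (G + aup ^+ 2 * MM)); first by lra.
    by field; rewrite gt_eqF.
  move=> /(ler_wpM2l e4).
  have -> : eps ^+ 4 / alow ^+ 2 * (2 * alow * SD) = 2 * (eps ^+ 4 / alow * SD).
    by field; rewrite gt_eqF.
  set B := Z + _ + _.
  have -> : eps ^+ 4 / alow ^+ 2 * (26 * B) = 26 / alow ^+ 2 * eps ^+ 4 * B by ring.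
  lra.
have P00 : ip (peps 0%N \- pzero 0%N) (peps 0%N \- pzero 0%N) = 0.
  have Qp := solution_Qh a g0 g1 p0 m0 n tau eps peps meps sol 0.
  have Qp' := solution_Qh a g0 g1 p0 m0 n tau 0 pzero mzero sol' 0.
  have Lp := Qh_in_L2 n n_gt0 _ Qp; have Lp' := Qh_in_L2 n n_gt0 _ Qp'.
  have Le := Qh_in_L2 n n_gt0 _ (Qh_sub n _ _ Qp Qp').
  by rewrite (ipBl _ _ _ Lp Lp' Le) (ae_eq_ip _ _ _ Lp Lp' Le init) subrr.
rewrite !L2normK (eq_bigr (fun j => tau *
    ip (meps j \- mzero j) (meps j \- mzero j))); last by move=> j _; rewrite L2normK.
apply: (arith _ _ _ _ _ _ (ip_ge0 _) (ip_ge0 _) (ip_ge0 _) (ip_ge0 _)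
  (comparison_sum a alow aup a_meas alow_gt0 a_bounds g0 g1 p0 m0 n tau eps
     n_gt0 tau_gt0 eps_gt0 peps meps pzero mzero sol sol' k P00)
  (sum_dtau_m_le a alow aup a_meas alow_gt0 a_bounds g0 g1 p0 dp0 m0 dm0 n tau eps
     Hp Hm bp n_gt0 tau_gt0 eps_gt0 peps meps sol k)).
Qed.
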